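(* For every nonnegative integer $n$ and every integer $k\geq 2$, $$\overline{b}_5(4n+3) = 2\overline{b}_5(2n)$$ and $$\overline{b}_5\left(5^{k}(n+3)-3\right) = \left(\frac{5^{k}-1}{4}\right)\overline{b}_5(5n+12) - \left(\frac{5^{k}-5}{4}\right)\overline{b}_5(n).$$
   Context: For $j\ge1$ let $f_j:=\prod_{k\ge 1}(1-q^{jk})$ (for $|q|<1$, or as a formal power series). Let $\psi(-q):=\sum_{n=0}^{\infty}(-q)^{n(n+1)/2}=f_1f_4/f_2$, so that $\psi(-q^5)=f_5f_{20}/f_{10}$. The integers $\overline{b}_5(n)$ are defined by $$\sum_{n=0}^\infty \overline{b}_5(n)q^n=\frac{\psi^5(-q^5)}{\psi(-q)}=1+q+q^2+2q^3+3q^4-q^5+2q^7-2q^9+6q^{10}+\cdots .$$ *)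

(* Defs.v *)
From mathcomp Require Import all_boot all_order all_algebra.
Set Implicit Arguments.
Unset Strict Implicit.
Unset Printing Implicit Defensive.
Import GRing.Theory.
Local Open Scope ring_scope.

(* A formal power series over Z is its coefficient sequence; series are
   compared with =1. *)
Definition fps := nat -> int.

Definition fps_one : fps := fun n => (n == 0%N)%:R.

Definition fps_mul (a b : fps) : fps :=
  fun n => \sum_(i < n.+1) a i * b (n - i)%N.

Definition fps_exp (a : fps) (k : nat) : fps := iter k (fps_mul a) fps_one.

(* The series a(c q^j), for 0 < j. *)
Definition fps_subst (c : int) (j : nat) (a : fps) : fps :=
  fun n => if (j %| n)%N then c ^+ (n %/ j) * a (n %/ j)%N else 0.

(* The quotient u / v of power series, meaningful when v has constant term 1:
   its coefficients are forced by
     b m = u m - \sum_(i < m) b i * v (m - i),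
   and fps_div_prefix u v n lists the first n of them. See fps_divK and
   fps_div_unique. *)
Fixpoint fps_div_prefix (u v : fps) (n : nat) : seq int :=
  if n is m.+1 then
    let s := fps_div_prefix u v m in
    rcons s (u m - \sum_(i < m) s`_i * v (m - i)%N)
  else [::].

Definition fps_div (u v : fps) : fps :=
  fun n => (fps_div_prefix u v n.+1)`_n.

Lemma size_fps_div_prefix u v n : size (fps_div_prefix u v n) = n.
Proof. by elim: n => //= n IHn; rewrite size_rcons IHn. Qed.

Lemma nth_fps_div_prefix u v n i :
  (i < n)%N -> (fps_div_prefix u v n)`_i = fps_div u v i.
Proof.
elim: n => // n IHn; rewrite ltnS leq_eqVlt => /predU1P[-> // | lt_in].
by rewrite /= nth_rcons size_fps_div_prefix lt_in IHn.
Qed.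

Lemma fps_divE u v n :
  fps_div u v n = u n - \sum_(i < n) fps_div u v i * v (n - i)%N.
Proof.
rewrite {1}/fps_div /= nth_rcons size_fps_div_prefix ltnn eqxx.
by congr (_ - _); apply: eq_bigr => i _; rewrite nth_fps_div_prefix.
Qed.

Lemma fps_divK u v : v 0%N = 1 -> fps_mul (fps_div u v) v =1 u.
Proof.
move=> v0 n; rewrite /fps_mul big_ord_recr /= subnn v0 mulr1.
by rewrite [fps_div u v n]fps_divE addrC subrK.
Qed.

Lemma fps_div_unique u v b :
  v 0%N = 1 -> fps_mul b v =1 u -> b =1 fps_div u v.
Proof.
move=> v0 bvu n; have [m] := ubnP n; elim: m n => // m IHm n le_nm.
rewrite fps_divE -(bvu n) /fps_mul big_ord_recr /= subnn v0 mulr1 addrAC.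
rewrite (_ : \sum_(i < n) _ = \sum_(i < n) fps_div u v i * v (n - i)%N).
  by rewrite subrr add0r.
by apply: eq_bigr => i _; rewrite IHm // (leq_trans (ltn_ord i)).
Qed.

(* psi(q) = \sum_(m >= 0) q^(m(m+1)/2), where 'C(m.+1, 2) = m(m+1)/2; only
   m <= n can contribute to q^n because m <= m(m+1)/2. *)
Definition psi : fps := fun n => \sum_(m < n.+1 | 'C(m.+1, 2) == n) 1.

(* psi(-q^j), for 0 < j. *)
Definition psi_neg (j : nat) : fps := fps_subst (-1) j psi.

(* \sum_n b5bar n q^n = psi(-q^5)^5 / psi(-q). *)
Definition b5bar : nat -> int := fps_div (fps_exp (psi_neg 5) 5) (psi_neg 1).

Lemma psi_neg_0 j : psi_neg j 0 = 1.
Proof.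
by rewrite /psi_neg /fps_subst dvdn0 div0n mul1r /psi big_mkcond big_ord1.
Qed.

Lemma b5barK : fps_mul b5bar (psi_neg 1) =1 fps_exp (psi_neg 5) 5.
Proof. exact/fps_divK/psi_neg_0. Qed.

(* Main.v *)
(* Write P = psi(q), R = psi(q^5), f_k for the eta products, A = f(q^2, q^3) and
   B = f(q, q^4) for Ramanujan's theta function f. The change q -> -q removes
   the signs, so the coefficients to study are those of G3 = q^3 R^5 / P.
   Put G1 = q P^3 R and G2 = q^2 P R^3.

   Everything rests on three identities between products of two theta series,
     P^2 - q R^2 = A B,
     phi(-q^5)^2 - phi(-q)^2 = 4 q f(-q, -q^9) f(-q^3, -q^7),
     phi(q) phi(-q^5) - phi(-q) phi(q^5) = 4 q f_4 f_20,
   each obtained by cutting Z^2 into the cosets of a sublattice of index 5 or 6.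
   With the triple product, the first two make P^2 - q R^2 and P^2 - 5 q R^2
   eta quotients.

   Let U_d f have q^n-coefficient that of q^(d n) in f. The 5-dissection
   P = A(q^5) + q B(q^5) + q^3 psi(q^25) gives U_5 G2 = G1 and
   U_5 G1 = 6 G1 - 5 G2. The third identity gives U_2 (G1 - G2) = 2 (G1 - G2)
   and U_2 (G1 - 5 G2) = - 2 (G1 - 5 G2), hence U_2 G2 = G1 - 3 G2.

   Finally G2 - G3 = H(q^2), where H = q f_5^5 / f_1 satisfies
   G1 - G2 = H(q) + H(q^2); so U_5 H = 5 H, because U_5 (G1 - G2) = 5 (G1 - G2).
   Comparing coefficients, the eigenvalues 1 and 5 of U_5 give the second claim,
   and odd indices give the first. *)
From HB Require Import structures.
Require Import Defs.
From mathcomp Require Import all_boot all_order all_algebra.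
From mathcomp Require Import boolp classical_sets functions cardinality fsbigop.
From mathcomp Require Import zify ring.
Set Implicit Arguments.
Unset Strict Implicit.
Unset Printing Implicit Defensive.
Import Order.TTheory GRing.Theory Num.Theory.
Local Open Scope ring_scope.

(** * The ring of formal power series *)

(** A name of its own, so that the ring product is the Cauchy product and not the pointwise one. *)
Definition series := nat -> int.

HB.instance Definition _ := gen_eqMixin series.
HB.instance Definition _ := gen_choiceMixin series.

Definition series_add (f g : series) : series := fun n => f n + g n.
Definition series_opp (f : series) : series := fun n => - f n.

Fact series_addA : associative series_add.
Proof. by move=> f g h; apply/funext => n; exact: addrA. Qed.
Fact series_addC : commutative series_add.
Proof. by move=> f g; apply/funext => n; exact: addrC. Qed.
Fact series_add0 : left_id (fun=> 0 : int) series_add.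
Proof. by move=> f; apply/funext => n; exact: add0r. Qed.
Fact series_addN : left_inverse (fun=> 0 : int) series_opp series_add.
Proof. by move=> f; apply/funext => n; exact: addNr. Qed.

HB.instance Definition _ :=
  GRing.isZmodule.Build series series_addA series_addC series_add0 series_addN.

Definition series_trunc (f : series) N : {poly int} := \poly_(i < N) f i.

(** The coefficient of index [n] in a product involves only indices up to [n], so truncation loses
    nothing; commutativity and associativity are thereby inherited from [{poly int}]. *)
Lemma series_trunc_mul (f g : series) N n : (n < N)%N ->
  fps_mul f g n = (series_trunc f N * series_trunc g N)`_n.
Proof.
move=> ltnN; rewrite coefM; apply: eq_bigr => i _; rewrite !coef_poly.
have le_in : (i <= n)%N by rewrite -ltnS ltn_ord.
by rewrite (leq_ltn_trans le_in ltnN) (leq_ltn_trans (leq_subr _ _) ltnN).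
Qed.

Lemma series_trunc_mul2 (f g h : series) n :
  fps_mul f (fps_mul g h) n =
  (series_trunc f n.+1 * (series_trunc g n.+1 * series_trunc h n.+1))`_n.
Proof.
rewrite coefM; apply: eq_bigr => i _; rewrite coef_poly ltn_ord.
by rewrite -series_trunc_mul // ltnS leq_subr.
Qed.

Fact series_mulC : commutative (fps_mul : series -> series -> series).
Proof.
by move=> f g; apply/funext => n; rewrite !(@series_trunc_mul _ _ n.+1) // mulrC.
Qed.

Fact series_mulA : associative (fps_mul : series -> series -> series).
Proof.
move=> f g h; apply/funext => n.
by rewrite [in RHS]series_mulC !series_trunc_mul2 mulrA mulrC.
Qed.

Fact series_mul1 : left_id (fps_one : series) fps_mul.
Proof.
move=> f; apply/funext => n; rewrite /fps_mul big_ord_recl /= mul1r subn0.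
by rewrite big1 ?addr0 // => i _; rewrite mul0r.
Qed.

Fact series_mulDl : left_distributive (fps_mul : series -> series -> series) +%R.
Proof.
move=> f g h; apply/funext => n.
change (fps_mul (f + g) h n = fps_mul f h n + fps_mul g h n).
by rewrite -big_split; apply: eq_bigr => i _; exact: mulrDl.
Qed.

Fact series_one_neq0 : (fps_one : series) != 0.
Proof. by apply/eqP => /(congr1 (fun f : series => f 0%N)). Qed.

HB.instance Definition _ := GRing.Zmodule_isComNzRing.Build series
  series_mulA series_mulC series_mul1 series_mulDl series_one_neq0.

Implicit Types f g h : series.

Lemma serD f g n : (f + g) n = f n + g n. Proof. by []. Qed.
Lemma serN f n : (- f) n = - f n. Proof. by []. Qed.
Lemma serB f g n : (f - g) n = f n - g n. Proof. by []. Qed.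
Lemma ser1 n : (1 : series) n = (n == 0%N)%:R. Proof. by []. Qed.
Lemma serM f g n : (f * g) n = \sum_(i < n.+1) f i * g (n - i)%N.
Proof. by []. Qed.
Lemma ser_sum (I : Type) (r : seq I) (P : pred I) (F : I -> series) n :
  (\sum_(i <- r | P i) F i) n = \sum_(i <- r | P i) F i n.
Proof. by elim/big_rec2: _ => // i x y _ <-. Qed.
Lemma serMn f k n : (f *+ k) n = f n *+ k.
Proof. by elim: k => // k IH; rewrite !mulrS serD IH. Qed.
Lemma serM0 f g : (f * g) 0%N = f 0%N * g 0%N.
Proof. by rewrite serM big_ord1. Qed.

Lemma serX0 f k : (f ^+ k) 0%N = f 0%N ^+ k.
Proof. by elim: k => // k IH; rewrite !exprS serM0 IH. Qed.

Definition serE := (serD, serN, serMn).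

Definition q : series := fun n => (n == 1%N)%:R.

Lemma qMS f n : (q * f) n.+1 = f n.
Proof.
rewrite serM big_ord_recl /= mul0r add0r big_ord_recl /= mul1r subSS subn0.
by rewrite big1 ?addr0 // => i _; rewrite mul0r.
Qed.

Lemma qM0 f : (q * f) 0%N = 0.
Proof. by rewrite serM0 mul0r. Qed.

Lemma qXM k f n : (q ^+ k * f) n = if (k <= n)%N then f (n - k)%N else 0.
Proof.
elim: k n => [|k IH] n; first by rewrite expr0 mul1r subn0.
by rewrite exprS -mulrA; case: n => [|n]; rewrite ?qM0 // qMS IH ltnS subSS.
Qed.

Lemma qXMD k f n : (q ^+ k * f) (k + n)%N = f n.
Proof. by rewrite qXM leq_addr addKn. Qed.

Lemma qX_inj k f g : q ^+ k * f = q ^+ k * g -> f = g.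
Proof.
by move=> eq_fg; apply/funext => n; rewrite -(qXMD k f) eq_fg qXMD.
Qed.

(** A series with constant term 1 is a unit, with inverse given by [fps_div]. This is how theta and
    eta factors are cancelled below. *)
Lemma serI f g h : f 0%N = 1 -> f * g = f * h -> g = h.
Proof.
move=> f0; pose f' : series := fps_div fps_one f => eq_fgh.
have f'f : f' * f = 1 by apply/funext => n; exact: fps_divK.
by rewrite -[g]mul1r -f'f -mulrA eq_fgh mulrA f'f mul1r.
Qed.

(** * Congruence modulo [q ^+ M] *)

Definition eqm M f g := forall n, (n < M)%N -> f n = g n.

Lemma eqm_refl M f : eqm M f f. Proof. by []. Qed.
Lemma eqm_sym M f g : eqm M f g -> eqm M g f.
Proof. by move=> fg n /fg. Qed.
Lemma eqm_trans M f g h : eqm M f g -> eqm M g h -> eqm M f h.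
Proof. by move=> fg gh n lt_nM; rewrite fg ?gh. Qed.

Lemma eqmM M f g f' g' : eqm M f g -> eqm M f' g' -> eqm M (f * f') (g * g').
Proof.
move=> fg fg' n lt_nM; rewrite !serM; apply: eq_bigr => i _.
by rewrite fg ?fg' //; apply: leq_ltn_trans lt_nM;
  rewrite ?leq_subr // -ltnS ltn_ord.
Qed.

Lemma eqm_prod M (I : Type) (r : seq I) (P : pred I) (F G : I -> series) :
  (forall i, P i -> eqm M (F i) (G i)) ->
  eqm M (\prod_(i <- r | P i) F i) (\prod_(i <- r | P i) G i).
Proof. by move=> FG; elim/big_rec2: _ => // i x y Pi xy; apply: eqmM => //; exact: FG. Qed.

Lemma eqm_sum M (I : Type) (r : seq I) (P : pred I) (F G : I -> series) :
  (forall i, P i -> eqm M (F i) (G i)) ->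
  eqm M (\sum_(i <- r | P i) F i) (\sum_(i <- r | P i) G i).
Proof.
move=> FG; elim/big_rec2: _ => // i x y Pi xy n ltnM.
by rewrite !serD FG ?xy.
Qed.

Lemma eqm_eq f g : (forall M, eqm M f g) -> f = g.
Proof. by move=> fg; apply/funext => n; exact: (fg n.+1). Qed.

Lemma eqmI M f g h : f 0%N = 1 -> eqm M (f * g) (f * h) -> eqm M g h.
Proof.
move=> f0; pose f' : series := fps_div fps_one f => eq_fgh.
have f'f : f' * f = 1 by apply/funext => n; exact: fps_divK.
rewrite -[g]mul1r -[h]mul1r -f'f -!mulrA.
by apply: eqmM.
Qed.

Lemma eqm_qX M k f : (M <= k)%N -> eqm M (q ^+ k * f) 0.
Proof.
by move=> leMk n ltnM; rewrite qXM leqNgt (leq_trans ltnM leMk).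
Qed.

(* dil d is q -> q^d, and dec d is the Hecke-type operator U_d. *)
Definition dil d f : series := fun n => if (d %| n)%N then f (n %/ d)%N else 0.
Definition dec d f : series := fun n => f (d * n)%N.

Lemma dilK d f : (0 < d)%N -> dec d (dil d f) = f.
Proof. by move=> d0; apply/funext => n; rewrite /dec /dil dvdn_mulr // mulKn. Qed.

Lemma decD d f g : dec d (f + g) = dec d f + dec d g. Proof. by []. Qed.
Lemma decN d f : dec d (- f) = - dec d f. Proof. by []. Qed.
Lemma decMn d f k : dec d (f *+ k) = dec d f *+ k.
Proof. by apply/funext => n; rewrite /dec !serMn. Qed.

(** U_d is linear over series in q^d: in the convolution at index [d * n], only the multiples of [d]
    contribute. *)
Lemma dec_dilM d f g : (0 < d)%N -> dec d (dil d f * g) = f * dec d g.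
Proof.
move=> d0; apply/funext => n; rewrite /dec !serM.
rewrite (bigID (fun i : 'I__ => d %| i)%N) /= [X in _ + X]big1 ?addr0; last first.
  by move=> i /negPf ndi; rewrite /dil ndi mul0r.
have le_in (i : 'I_n.+1) : (d * i < (d * n).+1)%N by rewrite ltnS leq_mul2l -ltnS ltn_ord orbT.
rewrite (reindex_onto (fun i : 'I_n.+1 => inord (d * i) : 'I_(d * n).+1)
                      (fun j : 'I_(d * n).+1 => inord (j %/ d))) /=.
  apply: eq_big => [i|i _]; rewrite inordK // ?mulKn //.
    by rewrite dvdn_mulr //= inord_val eqxx.
  by rewrite /dil dvdn_mulr // mulKn // mulnBr.
move=> j /dvdnP[k ek]; apply/val_inj; rewrite /= ek mulnK //.
have ltk : (k < n.+1)%N.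
  by have:= ltn_ord j; rewrite ek !ltnS mulnC leq_pmul2l.
rewrite (inordK ltk) inordK; first exact: mulnC.
by rewrite ltnS leq_mul2l -ltnS ltk orbT.
Qed.

Lemma dilM d f g : (0 < d)%N -> dil d (f * g) = dil d f * dil d g.
Proof.
move=> d0; apply/funext => n.
have [/dvdnP[m ->]|ndn] := boolP (d %| n)%N.
  have dilE h : dil d h (m * d)%N = h m by rewrite /dil dvdn_mull // mulnK.
  (* At a multiple of [d] the identity is [dec_dilM] with [dil d g] as second factor. *)
  have := congr1 (fun h : series => h m) (dec_dilM f (dil d g) d0).
  by rewrite /dec dilE mulnC => ->; rewrite -/(dec d (dil d g)) dilK.
rewrite {1}/dil (negPf ndn) serM big1 // => i _; rewrite /dil.
have [di|] := boolP (d %| i)%N; last by rewrite mul0r.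
rewrite dvdn_subl ?(negPf ndn) ?mulr0 // -ltnS; exact: ltn_ord.
Qed.

Lemma dil1 d : (0 < d)%N -> dil d 1 = 1.
Proof.
move=> d0; apply/funext => n; rewrite /dil !ser1.
case: ifP => [/dvdnP[m ->]|]; first by rewrite mulnK // muln_eq0 (gtn_eqF d0) orbF.
by case: n => //=; rewrite dvdn0.
Qed.

Lemma dilX d f k : (0 < d)%N -> dil d (f ^+ k) = dil d f ^+ k.
Proof. by move=> d0; elim: k => [|k IH]; rewrite ?dil1 // !exprS dilM // IH. Qed.

Lemma qXE k n : (q ^+ k) n = (n == k)%:R.
Proof.
rewrite -[q ^+ k]mulr1 qXM ser1 subn_eq0 eqn_leq.
by case: (k <= n)%N; rewrite ?andbT ?andbF.
Qed.

Lemma dilq d : (0 < d)%N -> dil d q = q ^+ d.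
Proof.
move=> d0; apply/funext => n; rewrite qXE /dil /q.
case: ifP => [/dvdnP[m ->]|]; first by rewrite mulnK // -(@eqn_pmul2r d _ 1) // mul1n.
by case: eqP => // ->; rewrite dvdnn.
Qed.

Lemma dilqX d k : (0 < d)%N -> dil d (q ^+ k) = q ^+ (d * k).
Proof. by move=> d0; rewrite dilX // dilq // exprM. Qed.

(** Used on d-dissections: the exponents of the term all lie in the residue class [r], so U_d keeps
    it only for [r = 0]. *)
Lemma dec_qX d k r f : (r < d)%N ->
  dec d (q ^+ (d * k + r) * dil d f) = if r == 0%N then q ^+ k * f else 0.
Proof.
move=> lt_rd; have d0 : (0 < d)%N by case: d lt_rd.
rewrite exprD -dilqX // -mulrA dec_dilM //.
case: eqP => [->|/eqP r0]; first by rewrite mul1r dilK.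
suff ->: dec d (q ^+ r * dil d f) = 0 by rewrite mulr0.
apply/funext => n; rewrite /dec qXM; case: leqP => // le_rn.
rewrite /dil dvdn_subr ?dvdn_mulr // /dvdn modn_small //.
by rewrite (negPf r0).
Qed.

(* The substitution q -> -q. *)
Definition sgn f : series := fun n => (-1) ^+ n * f n.

Lemma sgnE f n : sgn f n = (-1) ^+ n * f n. Proof. by []. Qed.

Lemma sgnK f : sgn (sgn f) = f.
Proof. by apply/funext => n; rewrite !sgnE mulrA -exprMn mulrNN mulr1 expr1n mul1r. Qed.

Lemma sgnM f g : sgn (f * g) = sgn f * sgn g.
Proof.
apply/funext => n; rewrite /sgn !serM mulr_sumr; apply: eq_bigr => i _.
have {1}->: n = (i + (n - i))%N by rewrite subnKC // -ltnS ltn_ord.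
by rewrite exprD; ring.
Qed.

Lemma sgn1 : sgn 1 = 1.
Proof. by apply/funext => -[|n]; rewrite /sgn ?mul1r // ser1 mulr0. Qed.

Lemma sgnX f k : sgn (f ^+ k) = sgn f ^+ k.
Proof. by elim: k => [|k IH]; rewrite ?sgn1 // !exprS sgnM IH. Qed.

(** * Generating functions *)

(* Meaningful when e has finite fibres (finfib e): a sum over an infinite
   support is 0 by convention. *)
Definition gen (T : choiceType) (e : T -> nat) (s : T -> int) : series :=
  fun n => \sum_(t \in [set t | e t = n]%classic) s t.

Definition finfib (T : choiceType) (e : T -> nat) :=
  forall n, exists2 r, uniq r & forall t, (e t <= n)%N -> t \in r.

Section Gen.
Variables (T T' : choiceType).
Implicit Types (e : T -> nat) (s : T -> int).

Lemma genE e s n r : uniq r -> (forall t, e t = n -> t \in r) ->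
  gen e s n = \sum_(t <- r | e t == n) s t.
Proof.
move=> ur rP; rewrite -big_filter fsbig_seq ?filter_uniq //.
apply: eq_fsbigl; apply/seteqP; split=> t /=; rewrite mem_filter.
  by move=> et; rewrite et eqxx rP.
by case/andP=> /eqP.
Qed.

Lemma eq_gen e e' s s' : e =1 e' -> s =1 s' -> gen e s = gen e' s'.
Proof. by move=> /funext-> /funext->. Qed.

Lemma gen_bij (g : T -> T') e s (e' : T' -> nat) (s' : T' -> int) :
  bijective g -> (forall t, e' (g t) = e t) -> (forall t, s' (g t) = s t) ->
  gen e s = gen e' s'.
Proof.
move=> [g' gK g'K] eg sg; apply/funext => n; rewrite /gen.
rewrite (reindex_fsbig g [set t | e t = n]%classic); last first.
  split=> [t /= <-|t u _ _ /(congr1 g')|t /=]; rewrite ?gK //.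
  by exists (g' t) => //=; rewrite -eg g'K.
by apply: eq_fsbigr => t _; rewrite sg.
Qed.

Lemma genN e s : gen e (fun t => - s t) = - gen e s.
Proof.
apply/funext => n; rewrite serN /gen.
have [fin|inf] := pselect (finite_set ([set t | e t = n]%classic `&` s @^-1` [set~ 0]))%classic.
  rewrite -mulN1r full_fsbig_distrr //; apply: eq_fsbigr => t _.
  exact/esym/mulN1r.
(* On an infinite support both sums take the default value 0. *)
rewrite !fsbig_dflt ?oppr0 //.
by congr (~ finite_set _): inf; apply/seteqP; split=> t /= [? ?]; split=> //; lia.
Qed.

Lemma gen_qX k e s : gen (fun t => k + e t)%N s = q ^+ k * gen e s.
Proof.
apply/funext => n; rewrite qXM; case: leqP => [le_kn|lt_nk].
  by apply: eq_fsbigl; apply/seteqP; split=> t /=; lia.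
by apply: fsbig1 => t /=; lia.
Qed.

Lemma gen_dil d e s : (0 < d)%N -> gen (fun t => d * e t)%N s = dil d (gen e s).
Proof.
move=> d0; apply/funext => n; rewrite /dil; case: ifP => [/dvdnP[m ->]|ndn].
  rewrite mulnK //; apply: eq_fsbigl; apply/seteqP; split=> t /=; nia.
by apply: fsbig1 => t /= ed; rewrite -ed dvdn_mulr in ndn.
Qed.

(** A covering list in [T] is pulled back along a partial inverse of [g], obtained by choice. *)
Lemma finfib_inj (g : T' -> T) e : injective g -> finfib e ->
  finfib (fun t => e (g t)).
Proof.
move=> gI fe n; have [r ur rP] := fe n.
have /choice[g' g'P] : forall t, exists o, forall u, g u = t -> o = Some u.
  move=> t; have [[u gu]|nu] := pselect (exists u, g u = t).
    by exists (Some u) => v; rewrite -gu => /gI->.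
  by exists None => u gu; case: nu; exists u.
exists (undup (pmap g' r)); first exact: undup_uniq.
move=> u eu; rewrite mem_undup mem_pmap; apply/mapP; exists (g u); first exact: rP.
by rewrite (g'P _ u).
Qed.

End Gen.

Lemma finfib_prod (T T' : choiceType) (e : T -> nat) (e' : T' -> nat) :
  finfib e -> finfib e' -> finfib (fun p : T * T' => e p.1 + e' p.2)%N.
Proof.
move=> fe fe' n; have [r ur rP] := fe n; have [r' ur' rP'] := fe' n.
exists [seq (t, t') | t <- r, t' <- r']; first by apply: allpairs_uniq => // -[? ?] [].
move=> [t t'] /= le_n; apply/allpairsP; exists (t, t') => /=.
by split=> //; [apply: rP|apply: rP']; lia.
Qed.

Lemma gen_mul (T T' : choiceType) e e' s s' : finfib e -> finfib e' ->
  gen e s * gen e' s' =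
  gen (fun p : T * T' => e p.1 + e' p.2)%N (fun p => s p.1 * s' p.2).
Proof.
move=> fe fe'; apply/funext => n.
have [r ur rP] := fe n; have [r' ur' rP'] := fe' n.
rewrite (@genE _ _ _ n [seq (t, t') | t <- r, t' <- r']); first last.
- move=> [t t'] /= le_n; apply/allpairsP; exists (t, t') => /=.
  by split=> //; [apply: rP|apply: rP']; lia.
- by apply: allpairs_uniq => // -[? ?] [].
rewrite serM [RHS]big_mkcond big_allpairs_dep /=.
(* The pairs are grouped by the value [i] of [e] on the first component. *)
transitivity (\sum_(i < n.+1) \sum_(t <- r | e t == i)
   \sum_(t' <- r' | (e t + e' t' == n)%N) s t * s' t').
  apply: eq_bigr => i _; rewrite (@genE _ e s i r) //; last first.
    by move=> t et; apply: rP; rewrite et -ltnS.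
  rewrite mulr_suml; apply: eq_bigr => t /eqP et.
  rewrite (@genE _ e' s' _ r') //; last by move=> t' et'; apply: rP'; rewrite et' leq_subr.
  rewrite mulr_sumr; apply: eq_bigl => t'; have:= ltn_ord i; lia.
under [LHS]eq_bigr do rewrite big_mkcond.
rewrite [LHS]exchange_big /=; apply: eq_bigr => t _; rewrite -big_mkcond /=.
rewrite -[RHS]big_mkcond /=.
have [le_tn|lt_nt] := leqP (e t) n.
  by rewrite (big_pred1 (Ordinal (le_tn : e t < n.+1)%N)) // => i; rewrite eq_sym.
rewrite big1; last by move=> i /eqP ei; have:= ltn_ord i; lia.
by rewrite big1 // => t' /eqP; lia.
Qed.

(** The first two hypotheses make [(i, u) -> c i u] a bijection, so the images of the [c i]
    partition [T]. In the applications they are cosets of a sublattice. *)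
Lemma gen_cosets (T T' : choiceType) k (c : 'I_k -> T' -> T) e s :
  (forall i j t u, c i t = c j u -> (i, t) = (j, u)) ->
  (forall t, exists i u, c i u = t) -> finfib e ->
  gen e s = \sum_(i < k) gen (fun u => e (c i u)) (fun u => s (c i u)).
Proof.
move=> cI cS fe; pose h (p : 'I_k * T') := c p.1 p.2.
have hI : injective h by move=> [i t] [j u]; exact: cI.
have /choice[g gP] : forall t, exists p, h p = t.
  by move=> t; have [i [u cu]] := cS t; exists (i, u).
have hb : bijective h by exists g => // p; apply: hI; rewrite gP.
rewrite -(gen_bij (e := e \o h) (s := s \o h) hb) //.
apply/funext => n; rewrite ser_sum.
have [r ur rP] := finfib_inj hI fe n.
rewrite (@genE _ _ _ n r) //; last by move=> t et; apply: rP; rewrite -et.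
rewrite (partition_big (fun p => p.1) xpredT) //=; apply: eq_bigr => i _.
have uri : uniq [seq p.2 | p <- r & p.1 == i].
  rewrite map_inj_in_uniq ?filter_uniq // => -[i1 u] [i2 v].
  by rewrite !mem_filter /= => /andP[/eqP-> _] /andP[/eqP-> _] ->.
rewrite (@genE _ _ _ n _ uri); last first.
  move=> u eu; apply/mapP; exists (i, u) => //; rewrite mem_filter eqxx /=.
  by apply: rP; rewrite /h /= eu.
rewrite big_map big_filter_cond; apply: congr_big => // -[j u] /=.
  by rewrite andbC; case: eqP => // ->.
by case/andP=> _ /eqP->.
Qed.

(** * Theta series *)

(** Twice the exponent a n(n+1)/2 + b n(n-1)/2: without the division, exponents can be compared by
    [ring] over [int]. *)
Definition theta_exp2 (a b : nat) (n : int) : int :=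
  a%:Z * (n * n + n) + b%:Z * (n * n - n).
Definition theta_exp (a b : nat) (n : int) : nat := (`|theta_exp2 a b n|./2)%N.
(** This is s^n when [s * s = 1], for negative [n] as well. *)
Definition sg (s n : int) : int := if odd `|n|%N then s else 1.

(* Ramanujan's theta function f(s q^a, s q^b), for s = 1 or s = -1. *)
HB.lock Definition theta s a b : series := gen (theta_exp a b) (sg s).

Lemma thetaE s a b : theta s a b = gen (theta_exp a b) (sg s).
Proof. by rewrite theta.unlock. Qed.

Lemma tri_even (n : int) : exists k : nat, n * n + n = k%:Z * 2.
Proof.
have: n = (n %/ 2)%Z * 2 \/ n = (n %/ 2)%Z * 2 + 1 by lia.
move: (n %/ 2)%Z => m; have mP : 0 <= m \/ m <= -1 by lia.
case=> ->.
  exists (absz (m * (m * 2 + 1))).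
  have: 0 <= m * (m * 2 + 1) by case: mP => mP; nia.
  lia.
exists (absz ((m * 2 + 1) * (m + 1))).
have: 0 <= (m * 2 + 1) * (m + 1) by case: mP => mP; nia.
lia.
Qed.

Lemma theta_expE a b n : (theta_exp a b n)%:Z * 2 = theta_exp2 a b n.
Proof.
have [k ek] := tri_even n; have [l el] := tri_even (- n).
have {}el : n * n - n = l%:Z * 2 by lia.
rewrite /theta_exp /theta_exp2 ek el; have ->: a%:Z * (k%:Z * 2) + b%:Z * (l%:Z * 2) = ((a * k + b * l).*2)%:Z.
  rewrite -muln2; nia.
by rewrite absz_nat doubleK; lia.
Qed.

Lemma theta_exp_ge a b n : (0 < a + b)%N -> (`|n| <= (theta_exp a b n).+1)%N.
Proof.
move=> ab0; have := theta_expE a b n; rewrite /theta_exp2; move: (theta_exp a b n) => x.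
have [k ek] := tri_even n; have [l el] := tri_even (- n).
(* Taken at [n] and at [- n], this bounds both n(n+1)/2 and n(n-1)/2 below by |n| - 1; the exponent
   is at least one of the two, since [a] or [b] is positive. *)
have bnd (m : int) : 0 <= (m - 1) * (m - 2).
  have [?|?] : m <= 1 \/ 2 <= m by lia.
    nia.
  nia.
have := bnd n; have := bnd (- n).
have -> : n * n - n = l%:Z * 2 by lia.
rewrite ek => b1 b2 ex.
have : k%:Z * 2 <= x%:Z * 2 \/ l%:Z * 2 <= x%:Z * 2.
  have [a1|b0]: 1 <= a%:Z \/ 1 <= b%:Z by lia.
    by left; nia.
  by right; nia.
lia.
Qed.

Lemma finfib_theta_exp a b : (0 < a + b)%N -> finfib (theta_exp a b).
Proof.
move=> ab0 n; exists [seq k%:Z - n.+1%:Z | k <- iota 0 (2 * n.+1).+1].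
  by rewrite map_inj_uniq ?iota_uniq // => k l; lia.
move=> t le_tn; have le_t := theta_exp_ge t ab0.
apply/mapP; exists (absz (t + n.+1%:Z)); last lia.
by rewrite mem_iota; lia.
Qed.

Lemma sg1 n : sg 1 n = 1. Proof. by rewrite /sg if_same. Qed.

Lemma sgN1 n : sg (-1) n = if (n %% 2)%Z == 0 then 1 else -1.
Proof. by rewrite /sg; case: ifP; case: eqP => //; lia. Qed.

(** Recognizes a coset sum as a signed, shifted theta series. The condition [e * e = 1] makes the
    substitution [m -> e * m + c] a bijection of Z; the exponents are matched after doubling. *)
Lemma gen_theta (neg : bool) k s a b e c (E : int -> nat) (S : int -> int) :
  e * e = 1 ->
  (forall m, (E m)%:Z * 2 = k%:Z * 2 + theta_exp2 a b (e * m + c)) ->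
  (forall m, S m = (-1) ^+ neg * sg s (e * m + c)) ->
  gen E S = (-1) ^+ neg * (q ^+ k * theta s a b).
Proof.
move=> ee hE hS.
transitivity ((-1) ^+ neg * gen E (fun m => sg s (e * m + c))).
  by case: neg hS => hS; rewrite ?mulN1r -?genN ?mul1r; apply: eq_gen => // m;
     rewrite hS ?mulN1r ?mul1r.
congr (_ * _); rewrite thetaE -gen_qX.
apply: (gen_bij (g := fun m => e * m + c)) => //.
  by exists (fun m => e * (m - c)) => m; rewrite ?addrK mulrA ee mul1r ?subrK.
by move=> m /=; have:= hE m; rewrite -theta_expE; lia.
Qed.

(** The same recognition on Z^2, when the quadratic form is diagonal in the new coordinates. *)
Lemma gen_theta_theta (neg : bool) k s a b s' a' b' e c e' c'
    (E : int * int -> nat) (S : int * int -> int) :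
  e * e = 1 -> e' * e' = 1 -> (0 < a + b)%N -> (0 < a' + b')%N ->
  (forall m n, (E (m, n))%:Z * 2 =
     k%:Z * 2 + theta_exp2 a b (e * m + c) + theta_exp2 a' b' (e' * n + c')) ->
  (forall m n, S (m, n) =
     (-1) ^+ neg * (sg s (e * m + c) * sg s' (e' * n + c'))) ->
  gen E S = (-1) ^+ neg * (q ^+ k * (theta s a b * theta s' a' b')).
Proof.
move=> ee ee' ab ab' hE hS.
transitivity ((-1) ^+ neg *
  gen E (fun p => sg s (e * p.1 + c) * sg s' (e' * p.2 + c'))).
  by case: neg hS => hS; rewrite ?mulN1r -?genN ?mul1r; apply: eq_gen => // -[m n];
     rewrite hS ?mulN1r ?mul1r.
congr (_ * _); rewrite !thetaE gen_mul; try exact: finfib_theta_exp.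
rewrite -gen_qX.
apply: (gen_bij (g := fun p => (e * p.1 + c, e' * p.2 + c'))) => //.
  by exists (fun p => (e * (p.1 - c), e' * (p.2 - c'))) => -[m n] /=;
     rewrite ?addrK !mulrA ?ee ?ee' !mul1r ?subrK.
by move=> [m n] /=; have:= hE m n; rewrite -!theta_expE; lia.
Qed.

Lemma dil_theta d s a b : (0 < d)%N -> dil d (theta s a b) = theta s (d * a) (d * b).
Proof.
move=> d0; rewrite !thetaE -gen_dil //; apply: eq_gen => // n.
suff: (d * theta_exp a b n)%N%:Z * 2 = (theta_exp (d * a) (d * b) n)%:Z * 2 by lia.
by rewrite PoszM -mulrA !theta_expE /theta_exp2 !PoszM; ring.
Qed.


Lemma thetaM s a b s' a' b' : (0 < a + b)%N -> (0 < a' + b')%N ->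
  theta s a b * theta s' a' b' =
  gen (fun p : int * int => theta_exp a b p.1 + theta_exp a' b' p.2)%N
      (fun p => sg s p.1 * sg s' p.2).
Proof. by move=> ? ?; rewrite !thetaE gen_mul //; apply: finfib_theta_exp. Qed.

Lemma finfib_theta_exp_add a b a' b' : (0 < a + b)%N -> (0 < a' + b')%N ->
  finfib (fun p : int * int => theta_exp a b p.1 + theta_exp a' b' p.2)%N.
Proof. by move=> ? ?; apply: finfib_prod; apply: finfib_theta_exp. Qed.

Lemma theta_cosets k s a b : (0 < k)%N -> (0 < a + b)%N -> theta s a b =
  \sum_(i < k) gen (fun m : int => theta_exp a b (k%:Z * m + i%:Z))
                   (fun m => sg s (k%:Z * m + i%:Z)).
Proof.
move=> k0 ab0; rewrite {1}thetaE.
rewrite (gen_cosets (c := fun (i : 'I_k) m => k%:Z * m + i%:Z)) //; last exact: finfib_theta_exp.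
- move=> i j t u /= eq_t; have:= ltn_ord i; have:= ltn_ord j => lti ltj.
  have etu: t = u by nia.
  by congr pair => //; apply/val_inj => /=; rewrite etu in eq_t; lia.
- move=> t; have rk : (`|(t %% k%:Z)%Z| < k)%N.
    have := modz_ge0 t (_ : k%:Z != 0); have := ltz_pmod t (_ : 0 < k%:Z); lia.
  exists (Ordinal rk), (t %/ k%:Z)%Z => /=.
  have t0 := modz_ge0 t (_ : k%:Z != 0).
  rewrite gez0_abs ?t0 //; last by lia.
  by rewrite mulrC -divz_eq.
Qed.

(* Z^2 is the union of the 5 translates by (i, 0) of the sublattice spanned by
   (2, -1) and (1, 2), on which x^2 + y^2 is diagonal. *)
Lemma thetaM_cosets5 s a b s' a' b' : (0 < a + b)%N -> (0 < a' + b')%N ->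
  theta s a b * theta s' a' b' =
  \sum_(i < 5)
    gen (fun p : int * int => theta_exp a b (p.1 * 2 + p.2 + i%:Z) +
                              theta_exp a' b' (p.2 * 2 - p.1))%N
        (fun p => sg s (p.1 * 2 + p.2 + i%:Z) * sg s' (p.2 * 2 - p.1)).
Proof.
move=> ab ab'; rewrite thetaM //.
rewrite (gen_cosets (c := fun (i : 'I_5) (p : int * int) =>
   (p.1 * 2 + p.2 + i%:Z, p.2 * 2 - p.1))) //; last exact: finfib_theta_exp_add.
- move=> i j [m n] [m' n'] /= [e1 e2]; have:= ltn_ord i; have:= ltn_ord j => lti ltj.
  have [-> [-> eij]] : m = m' /\ n = n' /\ i = j :> nat by lia.
  by congr (_, _); apply/val_inj.
- move=> [x y]; pose v := x + y * 2.
  have rk : (`|(v %% 5)%Z| < 5)%N by lia.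
  exists (Ordinal rk), ((v %/ 5)%Z * 2 - y, (v %/ 5)%Z) => /=.
  by rewrite /v; congr pair; lia.
Qed.

(** The sublattice spanned by (1, 1) and (5, -1) has index 6, and x^2 + 5 y^2 becomes 6 m^2 + 30 n^2
    on it. *)
Lemma thetaM_cosets6 s a b s' a' b' : (0 < a + b)%N -> (0 < a' + b')%N ->
  theta s a b * theta s' a' b' =
  \sum_(i < 6)
    gen (fun p : int * int => theta_exp a b (p.1 + 5 * p.2 + i%:Z) +
                              theta_exp a' b' (p.1 - p.2))%N
        (fun p => sg s (p.1 + 5 * p.2 + i%:Z) * sg s' (p.1 - p.2)).
Proof.
move=> ab ab'; rewrite thetaM //.
rewrite (gen_cosets (c := fun (i : 'I_6) (p : int * int) =>
   (p.1 + 5 * p.2 + i%:Z, p.1 - p.2))) //; last exact: finfib_theta_exp_add.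
- move=> i j [m n] [m' n'] /= [e1 e2]; have:= ltn_ord i; have:= ltn_ord j => lti ltj.
  have [-> [-> eij]] : m = m' /\ n = n' /\ i = j :> nat by lia.
  by congr (_, _); apply/val_inj.
- move=> [x y]; pose v := x - y.
  have rk : (`|(v %% 6)%Z| < 6)%N by lia.
  exists (Ordinal rk), (y + (v %/ 6)%Z, (v %/ 6)%Z) => /=.
  by rewrite /v; congr pair; lia.
Qed.

(** The exponent k n^2 has the parity of n when [k] is odd. *)
Lemma sgn_phi k s : odd k -> s * s = 1 -> sgn (theta s k k) = theta (- s) k k.
Proof.
move=> ok ss; apply/funext => n; rewrite /sgn.
have fin := finfib_theta_exp (_ : (0 < k + k)%N).
have [|r ur rP] := fin _ n; first by case: k ok {fin} => // k; rewrite addnS.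
rewrite !thetaE !(@genE _ _ _ n r) //; try by move=> t et; apply: rP; rewrite et.
rewrite mulr_sumr; apply: eq_bigr => t /eqP <-.
have : (theta_exp k k t)%:Z = k%:Z * (t * t).
  have := theta_expE k k t; rewrite /theta_exp2; nia.
move=> et; have -> : (-1) ^+ theta_exp k k t = (-1) ^+ odd `|t|%N :> int.
  rewrite -signr_odd; congr (_ ^+ nat_of_bool _).
  have -> : theta_exp k k t = (k * (`|t| * `|t|))%N by nia.
  by rewrite !oddM ok andbb.
by rewrite /sg; case: odd; rewrite ?mulN1r ?mul1r.
Qed.

(** * Theta identities from sublattices *)

(** Among the five cosets in psi(q)^2, the one with [i = 2] is q psi(q^5)^2. The other four are the
    terms of the product on the right once each of its factors is split by the parity of the
    index. *)
Lemma theta_AB :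
  theta 1 1 3 * theta 1 1 3 - q * (theta 1 5 15 * theta 1 5 15) = theta 1 2 3 * theta 1 1 4.
Proof.
have -> : theta 1 2 3 = theta 1 9 11 + q ^+ 2 * theta 1 1 19.
  rewrite (@theta_cosets 2) // !big_ord_recr big_ord0 /= add0r.
  rewrite (@gen_theta false 0 1 9 11 1 0) ?(@gen_theta false 2 1 1 19 (-1) 0) ?mul1r //.
  - by move=> m; rewrite theta_expE /theta_exp2; ring.
  - by move=> m; rewrite !sg1.
  - by move=> m; rewrite theta_expE /theta_exp2; ring.
  - by move=> m; rewrite !sg1.
have -> : theta 1 1 4 = theta 1 7 13 + q * theta 1 3 17.
  rewrite (@theta_cosets 2) // !big_ord_recr big_ord0 /= add0r.
  rewrite (@gen_theta false 0 1 7 13 1 0) ?(@gen_theta false 1 1 3 17 (-1) 0) ?mul1r //.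
  - by move=> m; rewrite theta_expE /theta_exp2; ring.
  - by move=> m; rewrite !sg1.
  - by move=> m; rewrite theta_expE /theta_exp2; ring.
  - by move=> m; rewrite !sg1.
rewrite thetaM_cosets5 // !big_ord_recr big_ord0 /= add0r.
rewrite (@gen_theta_theta false 0 1 9 11 1 7 13 1 0 1 0) //; first last.
- by move=> m n; rewrite !sg1.
- by move=> m n /=; rewrite PoszD mulrDl !theta_expE /theta_exp2; ring.
rewrite (@gen_theta_theta false 1 1 3 17 1 9 11 (-1) 0 (-1) 0) //; first last.
- by move=> m n; rewrite !sg1.
- by move=> m n /=; rewrite PoszD mulrDl !theta_expE /theta_exp2; ring.
rewrite (@gen_theta_theta false 1 1 5 15 1 5 15 1 1 (-1) 0) //; first last.
- by move=> m n; rewrite !sg1.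
- by move=> m n /=; rewrite PoszD mulrDl !theta_expE /theta_exp2; ring.
rewrite (@gen_theta_theta false 2 1 7 13 1 1 19 (-1) (-1) (-1) 0) //; first last.
- by move=> m n; rewrite !sg1.
- by move=> m n /=; rewrite PoszD mulrDl !theta_expE /theta_exp2; ring.
rewrite (@gen_theta_theta false 3 1 1 19 1 3 17 1 2 1 1) //; first last.
- by move=> m n; rewrite !sg1.
- by move=> m n /=; rewrite PoszD mulrDl !theta_expE /theta_exp2; ring.
by ring.
Qed.

(** Among the five cosets in phi(-q)^2, the one with [i = 0] is phi(-q^5)^2; each of the other four
    is - q f(-q, -q^9) f(-q^3, -q^7). *)
Lemma theta_M : theta (-1) 5 5 * theta (-1) 5 5 - theta (-1) 1 1 * theta (-1) 1 1 =
  4 * q * (theta (-1) 1 9 * theta (-1) 3 7).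
Proof.
rewrite [theta _ 1 1 * _]thetaM_cosets5 // !big_ord_recr big_ord0 /= add0r.
rewrite (@gen_theta_theta false 0 (-1) 5 5 (-1) 5 5 1 0 1 0) //; first last.
- by move=> m n; rewrite /= !sgN1 ; do ![case: eqP => ?]; lia.
- by move=> m n /=; rewrite PoszD mulrDl !theta_expE /theta_exp2; ring.
rewrite (@gen_theta_theta true 1 (-1) 1 9 (-1) 3 7 (-1) 0 (-1) 0) //; first last.
- by move=> m n; rewrite /= !sgN1 ; do ![case: eqP => ?]; lia.
- by move=> m n /=; rewrite PoszD mulrDl !theta_expE /theta_exp2; ring.
rewrite (@gen_theta_theta true 1 (-1) 3 7 (-1) 1 9 1 1 (-1) 0) //; first last.
- by move=> m n; rewrite /= !sgN1 ; do ![case: eqP => ?]; lia.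
- by move=> m n /=; rewrite PoszD mulrDl !theta_expE /theta_exp2; ring.
rewrite (@gen_theta_theta true 1 (-1) 3 7 (-1) 1 9 (-1) (-1) 1 1) //; first last.
- by move=> m n; rewrite /= !sgN1 ; do ![case: eqP => ?]; lia.
- by move=> m n /=; rewrite PoszD mulrDl !theta_expE /theta_exp2; ring.
rewrite (@gen_theta_theta true 1 (-1) 1 9 (-1) 3 7 1 2 1 1) //; first last.
- by move=> m n; rewrite /= !sgN1 ; do ![case: eqP => ?]; lia.
- by move=> m n /=; rewrite PoszD mulrDl !theta_expE /theta_exp2; ring.
by ring.
Qed.

Definition Tcoset (s s' : int) (i : nat) : series :=
  gen (fun p : int * int => theta_exp 1 1 (p.1 + 5 * p.2 + i%:Z) +
                              theta_exp 5 5 (p.1 - p.2))%N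
      (fun p => sg s (p.1 + 5 * p.2 + i%:Z) * sg s' (p.1 - p.2)).

(** Both products are cut into the same six cosets. The even cosets and coset 3 agree and cancel;
    cosets 1 and 5 are opposite, and each contributes 2 q f_4 f_20. *)
Lemma theta_T : theta 1 1 1 * theta (-1) 5 5 - theta (-1) 1 1 * theta 1 5 5 =
  4 * q * (theta (-1) 4 8 * theta (-1) 20 40).
Proof.
have cosets s s' : theta s 1 1 * theta s' 5 5 = \sum_(i < 6) Tcoset s s' i.
  exact: thetaM_cosets6.
rewrite !cosets.
have even_coset i : Tcoset (-1) 1 (i.*2) = Tcoset 1 (-1) (i.*2).
  apply: eq_gen => // p; rewrite !sg1 mulr1 mul1r !sgN1.
  by do ![case: eqP => ?]; lia.
have coset1 (neg : bool) s s' : (s, s') = (if neg then (-1, 1) else (1, -1)) ->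
    Tcoset s s' 1 = (-1) ^+ neg * (q ^+ 1 * (theta (-1) 4 8 * theta (-1) 20 40)).
  case: neg => -[-> ->]; apply: (@gen_theta_theta _ _ _ _ _ _ _ _ (-1) 0 (-1) 0) => // m n /=.
  - by rewrite PoszD mulrDl !theta_expE /theta_exp2; ring.
  - by rewrite !sg1 !sgN1; do ![case: eqP => ?]; lia.
  - by rewrite PoszD mulrDl !theta_expE /theta_exp2; ring.
  - by rewrite !sg1 !sgN1; do ![case: eqP => ?]; lia.
have coset5 (neg : bool) s s' : (s, s') = (if neg then (-1, 1) else (1, -1)) ->
    Tcoset s s' 5 = (-1) ^+ neg * (q ^+ 1 * (theta (-1) 4 8 * theta (-1) 20 40)).
  case: neg => -[-> ->]; apply: (@gen_theta_theta _ _ _ _ _ _ _ _ 1 1 1 1) => // m n /=.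
  - by rewrite PoszD mulrDl !theta_expE /theta_exp2; ring.
  - by rewrite !sg1 !sgN1; do ![case: eqP => ?]; lia.
  - by rewrite PoszD mulrDl !theta_expE /theta_exp2; ring.
  - by rewrite !sg1 !sgN1; do ![case: eqP => ?]; lia.
(* x + 5 y -> - (x + 5 y) preserves x^2 + 5 y^2 and exchanges the two signs. *)
have coset3 : Tcoset (-1) 1 3 = Tcoset 1 (-1) 3.
  apply: (gen_bij (g := fun p : int * int => (- 1 - p.1, p.2))) => [|[m n]|[m n]] /=.
  - by exists (fun p => (- 1 - p.1, p.2)) => -[m n] /=; congr pair; lia.
  - suff: forall x y : nat, x%:Z * 2 = y%:Z * 2 -> x = y by apply; rewrite !PoszD !mulrDl !theta_expE /theta_exp2; ring.
    by lia.
  - by rewrite !sg1 !sgN1; do ![case: eqP => ?]; lia.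
rewrite !big_ord_recr !big_ord0 /= !add0r.
have -> : Tcoset (-1) 1 0 = Tcoset 1 (-1) 0 := even_coset 0%N.
have -> : Tcoset (-1) 1 2 = Tcoset 1 (-1) 2 := even_coset 1%N.
have -> : Tcoset (-1) 1 4 = Tcoset 1 (-1) 4 := even_coset 2%N.
rewrite coset3.
rewrite (coset1 true (-1) 1) // (coset5 true (-1) 1) // (coset1 false 1 (-1)) //.
rewrite (coset5 false 1 (-1)) //.
by ring.
Qed.

(** The exponent k n(n-1)/2 is invariant under n -> 1 - n, which exchanges even and odd n. *)
Lemma theta01 k : (0 < k)%N -> theta 1 0 k = 2 * theta 1 k (3 * k).
Proof.
move=> k0; rewrite (@theta_cosets 2) // !big_ord_recr big_ord0 /= add0r.
rewrite (@gen_theta false 0 1 k (3 * k) 1 0) //; first last.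
- by move=> m; rewrite !sg1.
- by move=> m; rewrite theta_expE /theta_exp2 PoszM; ring.
rewrite (@gen_theta false 0 1 k (3 * k) (-1) 0) //; first last.
- by move=> m; rewrite !sg1.
- by move=> m; rewrite theta_expE /theta_exp2 PoszM; ring.
by ring.
Qed.

(** Doubling replaces psi(q) by f(1, q), with exponents n(n-1)/2. Modulo 5 the classes 0 and 1 give
    the first term, 2 and 4 the second, and 3 alone gives f(1, q^25) = 2 psi(q^25). *)
Lemma psi_dissection :
  theta 1 1 3 = theta 1 10 15 + q * theta 1 5 20 + q ^+ 3 * theta 1 25 75.
Proof.
suff eq2 : 2 * theta 1 1 3 = 2 * (theta 1 10 15 + q * theta 1 5 20 + q ^+ 3 * theta 1 25 75).
  apply/funext => n; have := congr1 (fun f : series => f n) eq2.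
  by rewrite /= !mulr_natl !serMn; lia.
rewrite -(@theta01 1) // (@theta_cosets 5) // !big_ord_recr big_ord0 /= add0r.
rewrite (@gen_theta false 0 1 10 15 1 0) //; first last.
- by move=> m; rewrite !sg1.
- by move=> m; rewrite theta_expE /theta_exp2; ring.
rewrite (@gen_theta false 0 1 10 15 (-1) 0) //; first last.
- by move=> m; rewrite !sg1.
- by move=> m; rewrite theta_expE /theta_exp2; ring.
rewrite (@gen_theta false 1 1 5 20 (-1) 0) //; first last.
- by move=> m; rewrite !sg1.
- by move=> m; rewrite theta_expE /theta_exp2; ring.
rewrite (@gen_theta false 3 1 0 25 (-1) 0) //; first last.
- by move=> m; rewrite !sg1.
- by move=> m; rewrite theta_expE /theta_exp2; ring.
rewrite (@gen_theta false 1 1 5 20 1 1) //; first last.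
- by move=> m; rewrite !sg1.
- by move=> m; rewrite theta_expE /theta_exp2; ring.
rewrite (@theta01 25) //.
by ring.
Qed.

Lemma psiE : psi = theta 1 1 3.
Proof.
have C2 m : ('C(m.+1, 2) * 2 = m * m.+1)%N.
  by elim: m => // m IH; rewrite binS mulnDl IH bin1; lia.
transitivity (gen (fun m => 'C(m.+1, 2)) (fun=> 1)).
  apply/funext => n; rewrite (@genE _ _ _ n (iota 0 n.+1)) ?iota_uniq //.
    by rewrite -[iota _ _]/(index_iota 0 n.+1) big_mkord.
  by move=> m em; rewrite mem_iota /=; have := C2 m; nia.
(* The exponent 2 n^2 - n takes each index m(m+1)/2 at n = (m+1)/2 for odd m and at n = -m/2 for
   even m. *)
pose g (m : nat) : int := if odd m then (uphalf m)%:Z else - (m./2)%:Z.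
rewrite thetaE; apply: (gen_bij (g := g)) => [|m|m]; last exact: sg1.
  exists (fun n : int => if n <= 0 then (absz n).*2 else (absz n).*2.-1) => m.
    by rewrite /g; case: ifP; case: ifP; lia.
  by rewrite /g; case: ifP; case: ifP; lia.
suff: (theta_exp 1 3 (g m))%:Z * 2 = 'C(m.+1, 2)%:Z * 2 by lia.
rewrite theta_expE /theta_exp2 -PoszM C2 /g.
have [] : (m = m./2.*2 \/ m = m./2.*2.+1)%N by lia.
  by move: m./2 => k ->; rewrite odd_double -mul2n; nia.
by move: m./2 => k ->; rewrite /= odd_double /= doubleK -mul2n; nia.
Qed.

(** * The Jacobi triple product *)

Section QBinomial.
Variables (R : comNzRingType) (Q : R).

(** The Gaussian binomial coefficient, by its Pascal rule: no division is involved, so [Q] may be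
    any element of [R]. *)
Fixpoint gbin (m k : nat) : R :=
  match m, k with
  | _, 0%N => 1
  | 0%N, _.+1 => 0
  | m'.+1, k'.+1 => gbin m' k' + Q ^+ k * gbin m' k
  end.

Definition qfac m := \prod_(i < m) (1 - Q ^+ i.+1).

Lemma gbin0 m : gbin m 0 = 1. Proof. by case: m. Qed.

Lemma gbin_small m k : (m < k)%N -> gbin m k = 0.
Proof.
by elim: m k => [|m IH] [|k] //= lt_mk; rewrite !IH ?mulr0 ?addr0 // ltnW.
Qed.

Lemma gbinn m : gbin m m = 1.
Proof. by elim: m => //= m ->; rewrite gbin_small // mulr0 addr0. Qed.

(** Homogeneous q-binomial theorem. Removing the first factor turns [z] into [z * Q], and comparing
    powers of [z] gives the Pascal rule of [gbin]. *)
Lemma qbinomial m w z : \prod_(i < m) (w + z * Q ^+ i) =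
  \sum_(k < m.+1) gbin m k * Q ^+ 'C(k, 2) * z ^+ k * w ^+ (m - k).
Proof.
elim: m z => [|m IH] z; first by rewrite big_ord0 big_ord1 !mulr1.
rewrite big_ord_recl expr0 mulr1.
under eq_bigr do rewrite /bump /= exprS mulrA.
rewrite IH mulrDl !mulr_sumr [X in X + _]big_ord_recl.
rewrite [X in _ + X + _](_ : _ =
  \sum_(k < m.+1) gbin m k.+1 * Q ^+ 'C(k.+1, 2) * (z * Q) ^+ k.+1 * w ^+ (m - k)).
  rewrite -addrA -big_split [RHS]big_ord_recl; congr (_ + _).
    by rewrite !gbin0 !subn0 !expr0 exprS; ring.
  apply: eq_bigr => k _; rewrite /bump /= subSS binS bin1 exprD !exprMn !exprS.
  by ring.
rewrite [RHS]big_ord_recr /= gbin_small // !mul0r addr0.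
apply: eq_bigr => k _; rewrite /bump /= !add1n.
by rewrite -(subnSK (ltn_ord k)) [w ^+ _.+1]exprS; ring.
Qed.

Lemma gbin_qfac i j : gbin (i + j) i * qfac i * qfac j = qfac (i + j).
Proof.
have [m] := ubnP (i + j); elim: m i j => // m IH [|i] [|j] ltm.
- by rewrite /qfac !big_ord0 gbin0 !mulr1.
- by rewrite gbin0 {1}/qfac big_ord0 !mul1r.
- by rewrite addn0 gbinn [qfac 0]big_ord0 mulr1 mul1r.
have e1 := IH i j.+1; have e2 := IH i.+1 j.
have qfacS k : qfac k.+1 = qfac k * (1 - Q ^+ k.+1) by rewrite /qfac big_ord_recr.
(* The two terms of the Pascal rule recombine by 1 - Q^(i+j+2) = (1 - Q^(i+1)) + Q^(i+1) (1 -
   Q^(j+1)). *)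
transitivity (gbin (i + j.+1) i * qfac i * qfac j.+1 * (1 - Q ^+ i.+1) +
  Q ^+ i.+1 * (gbin (i.+1 + j) i.+1 * qfac i.+1 * qfac j) * (1 - Q ^+ j.+1)).
  by rewrite !addSn addnS /= !qfacS; ring.
rewrite e1 ?e2; [|lia..].
rewrite addSnnS [qfac (i + j.+1)]lock addSn qfacS -lock -addSn exprD; ring.
Qed.

End QBinomial.

Lemma serMz (f : series) (z : int) n : (z%:~R * f) n = z * f n.
Proof.
rewrite mulrzl; case: z => k; rewrite /intmul /= ?serN serMn -mulr_natl ?NegzE //.
  by rewrite natz.
by rewrite natz mulNr.
Qed.

Definition pochn (c : series) a m N : series :=
  \prod_(i < N) (1 - c * q ^+ (a + m * i)).
(** The infinite product (c q^a; q^m). For positive [a] and [m], later factors no longer affect the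
    coefficient of index [n]. *)
Definition poch c a m : series := fun n => pochn c a m n.+1 n.

Lemma pochn_stable c a m M N : (0 < a)%N -> (0 < m)%N -> (M <= N)%N ->
  eqm M (pochn c a m M) (pochn c a m N).
Proof.
move=> a0 m0 /subnKC <-; elim: (N - M)%N => [|k IH]; first by rewrite addn0.
apply: eqm_trans IH _; rewrite addnS /pochn [in X in eqm _ _ X]big_ord_recr /=.
rewrite mulrBr mulr1 mulrCA mulrA mulrC => n ltnM.
rewrite serB (@eqm_qX M) ?subr0 //.
nia.
Qed.

Lemma pochE c a m M N : (0 < a)%N -> (0 < m)%N -> (M <= N)%N ->
  eqm M (poch c a m) (pochn c a m N).
Proof.
move=> a0 m0 leMN n ltnM; rewrite /poch.
by apply: (pochn_stable c a0 m0 (leq_trans ltnM leMN)).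
Qed.

Lemma poch0 c a m : (0 < a)%N -> poch c a m 0%N = 1.
Proof.
move=> a0; rewrite /poch /pochn big_ord1 serB mulrC muln0 addn0 -[a]prednK //.
by rewrite exprS -mulrA qM0 subr0.
Qed.

Section TripleProduct.
Variables (s : int) (a b : nat).
Hypotheses (ss : s * s = 1) (a0 : (0 < a)%N) (b0 : (0 < b)%N).
Let c : series := s%:~R.
Let Q : series := q ^+ (a + b).
Let t (j : int) : series := (sg s j)%:~R * q ^+ theta_exp a b j.

Let cc : c * c = 1. Proof. by rewrite -intrM ss. Qed.

(** Finite form of the triple product: the q-binomial theorem with [n + n] factors, w = Q^n and z =
    c q^a, multiplied by a power of q that clears the negative exponents. *)
Let jtp_finite n :
  pochn (- c) a (a + b) n * pochn (- c) b (a + b) n =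
  \sum_(k < (n + n).+1) gbin Q (n + n) k * t (k%:Z - n%:Z).
Proof.
(* The monomials pulled out of the first [n] factors give q^(a n) Q^C(n,2), those out of the last
   [n] give Q^(n n). *)
pose D := (a * n + (a + b) * ('C(n, 2) + n * n))%N.
apply: (@qX_inj D).
transitivity (c ^+ n * \prod_(i < n + n) (Q ^+ n + c * q ^+ a * Q ^+ i)).
  rewrite big_split_ord /= (reindex_inj rev_ord_inj) /=.
  have -> : \prod_(i < n) (Q ^+ n + c * q ^+ a * Q ^+ (n - i.+1)) =
      \prod_(i < n) (c * q ^+ a * Q ^+ (n - i.+1)) * pochn (- c) b (a + b) n.
    rewrite /pochn -big_split; apply: eq_bigr => i _ /=.
    have -> : Q ^+ n = Q * Q ^+ i * Q ^+ (n - i.+1).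
      by rewrite -exprS -exprD subnKC.
    have -> : q ^+ (b + (a + b) * i) = q ^+ b * Q ^+ i by rewrite exprD exprM.
    have eQ : Q = q ^+ a * q ^+ b := exprD _ _ _.
    move: (Q ^+ i) (Q ^+ (n - i.+1)) => u v; rewrite eQ.
    transitivity (q ^+ a * q ^+ b * u * v * (c * c) + c * q ^+ a * v); last by ring.
    by rewrite cc mulr1.
  have -> : \prod_(i < n) (Q ^+ n + c * q ^+ a * Q ^+ (n + i)) =
      Q ^+ (n * n) * pochn (- c) a (a + b) n.
    have -> : Q ^+ (n * n) = \prod_(i < n) Q ^+ n.
      by rewrite prodr_const card_ord exprM.
    rewrite /pochn -big_split.
    apply: eq_bigr => i _ /=.
    by rewrite exprD [q ^+ (a + _)]exprD exprM -/Q; ring.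
  rewrite big_split prodr_const card_ord exprMn /=.
  have -> : \prod_(i < n) Q ^+ (n - i.+1) = Q ^+ 'C(n, 2).
    rewrite prodrXr (reindex_inj rev_ord_inj) -bin2_sum big_mkord.
    by congr (_ ^+ _); apply: eq_bigr => i _; rewrite /= subnSK // subKn // ltnW.
  transitivity ((c * c) ^+ n * ((q ^+ a) ^+ n * (Q ^+ 'C(n, 2) * Q ^+ (n * n)))
     * (pochn (- c) a (a + b) n * pochn (- c) b (a + b) n)).
    by rewrite cc expr1n mul1r -exprD -!exprM -exprD.
  by rewrite exprMn; ring.
rewrite qbinomial !mulr_sumr; apply: eq_bigr => k _ /=.
have lekn : (k <= n + n)%N by rewrite -ltnS.
rewrite [RHS]mulrCA; transitivity (gbin Q (n + n) k * (c ^+ n * c ^+ k *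
   (Q ^+ 'C(k, 2) * (q ^+ a) ^+ k * (Q ^+ n) ^+ (n + n - k)))).
  by rewrite [(c * q ^+ a) ^+ k]exprMn; ring.
congr (_ * _); rewrite /t.
have -> : c ^+ n * c ^+ k = (sg s (k%:Z - n%:Z))%:~R.
  have c2 m : c ^+ (m.*2) = 1 by rewrite -muln2 mulnC exprM expr2 cc expr1n.
  rewrite -exprD /sg -(odd_double_half (n + k)) exprD c2 mulr1.
  have -> : odd `|k%:Z - n%:Z|%N = odd (n + k) by lia.
  by case: odd.
rewrite [RHS]mulrCA; congr (_ * _).
rewrite -!exprM -!exprD; congr (_ ^+ _).
suff: forall x y : nat, x%:Z * 2 = y%:Z * 2 -> x = y; last by lia.
apply; rewrite /D !PoszD mulrDl [in RHS]mulrDl theta_expE /theta_exp2 !PoszM !PoszD.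
have C2 m : 'C(m, 2)%:Z * 2 = m%:Z * m%:Z - m%:Z.
  elim: m => // m IH; rewrite binS PoszD mulrDl IH bin1; lia.
rewrite !mulrDl -!mulrA !C2 -subzn // PoszD; ring: (C2 n) (C2 k).
Qed.

Theorem jacobi_triple_product : theta s a b =
  poch (- s%:~R) a (a + b) * poch (- s%:~R) b (a + b) * poch 1 (a + b) (a + b).
Proof.
rewrite -/c.
have ab0 : (0 < a + b)%N by rewrite addn_gt0 a0.
(* With this choice, |j| <= M forces both [k] and [n + n - k] to be at least [M], so their
   q-factorials have reached the limit [F] modulo q^M. *)
apply/esym/eqm_eq => M; pose n := (M + M)%N.
have leMn : (M <= n)%N by rewrite leq_addr.
pose F := poch 1 (a + b) (a + b).
have qfacE N : qfac Q N = pochn 1 (a + b) (a + b) N.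
  by apply: eq_bigr => i _; rewrite mul1r -exprM mulnS.
have FE N : (M <= N)%N -> eqm M F (qfac Q N).
  by move=> leMN; rewrite qfacE; apply: pochE.
apply: (@eqm_trans _ _ (pochn (- c) a (a + b) n * pochn (- c) b (a + b) n * F)).
  by apply: eqmM => //; apply: eqmM; apply: pochE.
rewrite jtp_finite mulr_suml.
apply: (@eqm_trans _ _ (\sum_(k < (n + n).+1) t (k%:Z - n%:Z))).
  apply: eqm_sum => k _; set j := k%:Z - n%:Z.
  (* For |j| > M the term vanishes modulo q^M, its exponent being at least |j| - 1. *)
  have [lt_Mj|le_jM] := ltnP M `|j|.
    have t0 : eqm M (t j) 0.
      rewrite /t mulrC; apply: eqm_qX; have := theta_exp_ge j ab0; lia.
    apply: (@eqm_trans _ _ 0); last exact: eqm_sym.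
    by have /(_ F F (@eqm_refl _ _)) := eqmM (eqmM (@eqm_refl M (gbin Q (n + n) k)) t0);
      rewrite mulr0 mul0r.
  rewrite -[X in eqm M _ X]mul1r mulrAC; apply: eqmM => //.
  (* It remains to see that the Gaussian binomial times [F] is 1 modulo q^M. One more factor [F]
     turns this into [gbin_qfac]. *)
  apply: (@eqmI _ F); first exact: poch0.
  have kn : (k <= n + n)%N by rewrite -ltnS.
  have ek : (n + n = k + (n + n - k))%N by rewrite subnKC.
  rewrite mulr1 mulrCA mulrA.
  apply: (@eqm_trans _ _ (qfac Q (n + n))); last by apply: eqm_sym; apply: FE; lia.
  rewrite {3}ek -gbin_qfac -ek.
  by apply: eqmM; first apply: eqmM => //; apply: FE; move: le_jM kn; rewrite /j /n; lia.
move=> m ltmM; rewrite ser_sum thetaE.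
rewrite (@genE _ _ _ m [seq k%:Z - n%:Z | k <- iota 0 (n + n).+1]).
- rewrite big_map -[iota _ _]/(index_iota 0 (n + n).+1) big_mkord [RHS]big_mkcond.
  apply: eq_bigr => k _; rewrite /t serMz qXE eq_sym.
  by case: eqP; rewrite ?mulr1 ?mulr0.
- by rewrite map_inj_uniq ?iota_uniq // => k l; lia.
move=> j ej; have := theta_exp_ge j ab0; rewrite ej => lej.
apply/mapP; exists (absz (j + n%:Z)); last lia.
by rewrite mem_iota; lia.
Qed.

End TripleProduct.

Lemma theta0 s a b : (0 < a)%N -> (0 < b)%N -> s * s = 1 -> theta s a b 0%N = 1.
Proof.
by move=> a0 b0 ss; rewrite jacobi_triple_product // !serM0 !poch0 ?addn_gt0 ?a0.
Qed.

(** * Eta products *)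

Lemma prod_ordM (R : comNzRingType) d N (F : nat -> R) :
  \prod_(i < d * N) F i = \prod_(r < d) \prod_(j < N) F (r + d * j)%N.
Proof.
elim: N => [|N IH].
  by rewrite muln0 big_ord0 big1 // => r _; rewrite big_ord0.
rewrite mulnS addnC big_split_ord /= IH -big_split /=.
by apply: eq_bigr => r _; rewrite big_ord_recr /= addnC.
Qed.

(** The factors are grouped by the residue of their index modulo [d]. *)
Lemma poch_split d c a m : (0 < a)%N -> (0 < m)%N -> (0 < d)%N ->
  poch c a m = \prod_(r < d) poch c (a + r * m) (d * m).
Proof.
move=> a0 m0 d0; apply: eqm_eq => M.
apply: (eqm_trans (pochE (N := (d * M)%N) c a0 m0 _)); first by rewrite leq_pmull.
rewrite /pochn (prod_ordM _ _ (fun i => 1 - c * q ^+ (a + m * i))); apply: eqm_prod => r _; apply: eqm_sym.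
rewrite (_ : \prod_(j < M) _ = pochn c (a + r * m) (d * m) M).
  by apply: pochE; rewrite ?addn_gt0 ?a0 ?muln_gt0 ?d0.
by apply: eq_bigr => j _; congr (1 - c * q ^+ _); ring.
Qed.

Lemma poch_sqr a m : (0 < a)%N -> (0 < m)%N ->
  poch 1 a m * poch (-1) a m = poch 1 (2 * a) (2 * m).
Proof.
move=> a0 m0; apply: eqm_eq => M.
apply: (@eqm_trans _ _ (pochn 1 a m M * pochn (-1) a m M)).
  by apply: eqmM; apply: pochE.
apply: eqm_sym; rewrite /pochn -big_split /=.
rewrite (_ : \prod_(i < M) _ = pochn 1 (2 * a) (2 * m) M).
  by apply: pochE; rewrite ?muln_gt0.
apply: eq_bigr => i _.
have -> : (2 * a + 2 * m * i = (a + m * i) * 2)%N by ring.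
by rewrite exprM; ring.
Qed.

(* f_k in the usual notation. *)
HB.lock Definition eta k : series := poch 1 k k.

Lemma etaE k : eta k = poch 1 k k.
Proof. by rewrite eta.unlock. Qed.

Lemma eta_split k : (0 < k)%N -> eta k = poch 1 k (2 * k) * eta (2 * k).
Proof.
move=> k0; rewrite !etaE (@poch_split 2 1 k k) // !big_ord_recl big_ord0 mulr1 /=.
by rewrite mul0n addn0 /bump /= addn0 mul1n addnn -mul2n.
Qed.

Lemma jtp1 a b : (0 < a)%N -> (0 < b)%N ->
  theta 1 a b = poch (-1) a (a + b) * poch (-1) b (a + b) * eta (a + b).
Proof. by move=> a0 b0; rewrite jacobi_triple_product // etaE. Qed.

Lemma jtpN1 a b : (0 < a)%N -> (0 < b)%N ->
  theta (-1) a b = poch 1 a (a + b) * poch 1 b (a + b) * eta (a + b).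
Proof. by move=> a0 b0; rewrite jacobi_triple_product // mulrN1z opprK etaE. Qed.

(** Euler's pentagonal number theorem: the three factors of the triple product are the residue
    classes modulo 3 in f_k. *)
Lemma eta_theta k : (0 < k)%N -> theta (-1) k (2 * k) = eta k.
Proof.
move=> k0; rewrite jtpN1 ?muln_gt0 //.
rewrite !etaE (@poch_split 3 1 k k) // !big_ord_recl big_ord0 mulr1 /= /bump /=.
by rewrite mul0n !addn0 !mul1n addnn -mul2n -mulSn -!mulrA.
Qed.

(** That is, psi(q^k) = f_2k^2 / f_k. Here and below, eta quotients are stated with denominators
    cleared. *)
Lemma psi_eta k : (0 < k)%N -> theta 1 k (3 * k) * eta k = eta (2 * k) ^+ 2.
Proof.
move=> k0; have k20 : (0 < 2 * k)%N by rewrite muln_gt0.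
rewrite jtp1 ?muln_gt0 // -mulSn.
have -> : poch (-1) k (4 * k) * poch (-1) (3 * k) (4 * k) = poch (-1) k (2 * k).
  rewrite (@poch_split 2 (-1) k (2 * k)) // !big_ord_recl big_ord0 mulr1 /= /bump /=.
  by rewrite mul0n addn0 mul1n -mulSn mulnA.
rewrite [eta k]eta_split // mulrACA [_ * poch 1 k _]mulrC poch_sqr //.
by rewrite [in RHS]expr2 {2}(eta_split k20) (mulnA 2 2 k) mulrA.
Qed.

Lemma phi_eta k : (0 < k)%N -> theta (-1) k k * eta (2 * k) = eta k ^+ 2.
Proof. by move=> k0; rewrite jtpN1 // addnn -mul2n (eta_split k0); ring. Qed.

Lemma phi_phi k : (0 < k)%N ->
  theta 1 k k * theta (-1) k k = theta (-1) (2 * k) (2 * k) ^+ 2.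
Proof.
move=> k0; have k20 : (0 < 2 * k)%N by rewrite muln_gt0.
rewrite jtp1 // !jtpN1 // !addnn -!mul2n (eta_split k20) -(poch_sqr k0 k20).
by ring.
Qed.

(** The products over the residues 1, 2, 3, 4 modulo 5 are completed by the residue 0 to (-q; q) =
    f_2 / f_1. *)
Lemma AB_eta : theta 1 2 3 * theta 1 1 4 * (eta 1 * eta 10) = eta 2 * eta 5 ^+ 3.
Proof.
rewrite !jtp1 //.
have -> : eta 2 = eta 1 * poch (-1) 1 1 by rewrite !etaE poch_sqr.
have -> : eta 10 = eta 5 * poch (-1) 5 5 by rewrite !etaE poch_sqr.
rewrite (@poch_split 5 _ 1 1) // !big_ord_recl big_ord0 /=; ring.
Qed.

(** The products over the residues 1, 3, 7, 9 modulo 10 are completed by the residue 5 to (q; q^2) =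
    f_1 / f_2. *)
Lemma CD_eta :
  theta (-1) 1 9 * theta (-1) 3 7 * (eta 5 * eta 2) = eta 1 * eta 10 ^+ 3.
Proof.
rewrite !jtpN1 // (@eta_split 1) // (@eta_split 5) //.
rewrite (@poch_split 5 _ 1 (2 * 1)) // !big_ord_recl big_ord0 /=; ring.
Qed.

Lemma eta0 k : (0 < k)%N -> eta k 0%N = 1.
Proof. by rewrite etaE; exact: poch0. Qed.

Lemma dil_eta d k : (0 < d)%N -> (0 < k)%N -> dil d (eta k) = eta (d * k).
Proof.
move=> d0 k0; rewrite -!eta_theta ?muln_gt0 ?d0 // dil_theta //.
by rewrite mulnCA.
Qed.

(** * The modular forms G1 and G2 *)

(** [psi1] and [psi5] are P and R, and [K] is A B, equal to P^2 - q R^2. Together with [L], it gives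
    G1 - G2 = q P R K and G1 - 5 G2 = q P R L. *)
Notation psi1 := (theta 1 1 3).
Notation psi5 := (theta 1 5 15).
Notation K := (theta 1 2 3 * theta 1 1 4).
Notation L := (psi1 ^+ 2 - 5 * q * psi5 ^+ 2).

Definition G1 : series := q * psi1 ^+ 3 * psi5.
Definition G2 : series := q ^+ 2 * psi1 * psi5 ^+ 3.

Lemma psi1_eta : psi1 * eta 1 = eta 2 ^+ 2. Proof. exact: (@psi_eta 1). Qed.
Lemma psi5_eta : psi5 * eta 5 = eta 10 ^+ 2. Proof. exact: (@psi_eta 5). Qed.
Lemma phi1_eta : theta (-1) 1 1 * eta 2 = eta 1 ^+ 2. Proof. exact: (@phi_eta 1). Qed.
Lemma phi5_eta : theta (-1) 5 5 * eta 10 = eta 5 ^+ 2. Proof. exact: (@phi_eta 5). Qed.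

Lemma KE : psi1 ^+ 2 - q * psi5 ^+ 2 = K.
Proof. by rewrite -theta_AB !expr2. Qed.

(** Since L = K - 4 q R^2, the eta forms of K and R reduce the claim to [theta_M], multiplied by eta
    factors that clear its denominators. *)
Lemma L_eta : L * (eta 2 * eta 5) = eta 1 ^+ 3 * eta 10.
Proof.
apply: (@serI (eta 1 * eta 10 * eta 5)); first by rewrite !(serM0, serX0, eta0).
transitivity ((K * (eta 1 * eta 10)) * eta 2 * eta 5 ^+ 2
  - 4 * q * (psi5 * eta 5) ^+ 2 * eta 1 * eta 2 * eta 10).
  by rewrite -KE; ring.
rewrite AB_eta psi5_eta.
have := theta_M => /(congr1 (fun x => x * (eta 2 ^+ 2 * eta 10 ^+ 2 * eta 5))).
have -> : (theta (-1) 5 5 * theta (-1) 5 5 - theta (-1) 1 1 * theta (-1) 1 1) *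
    (eta 2 ^+ 2 * eta 10 ^+ 2 * eta 5) =
    (theta (-1) 5 5 * eta 10) ^+ 2 * eta 2 ^+ 2 * eta 5 -
    (theta (-1) 1 1 * eta 2) ^+ 2 * eta 10 ^+ 2 * eta 5 by ring.
have -> : 4 * q * (theta (-1) 1 9 * theta (-1) 3 7) * (eta 2 ^+ 2 * eta 10 ^+ 2 * eta 5)
  = 4 * q * (theta (-1) 1 9 * theta (-1) 3 7 * (eta 5 * eta 2)) * (eta 2 * eta 10 ^+ 2)
  by ring.
rewrite CD_eta phi1_eta phi5_eta => /eqP; rewrite subr_eq => /eqP e.
transitivity ((eta 5 ^+ 2) ^+ 2 * eta 2 ^+ 2 * eta 5
  - 4 * q * (eta 1 * eta 10 ^+ 3) * (eta 2 * eta 10 ^+ 2)); first by ring.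
by rewrite e; ring.
Qed.

Definition phi_cross : series := theta 1 1 1 * theta (-1) 5 5.

Lemma sgn_phi_cross : sgn phi_cross = theta (-1) 1 1 * theta 1 5 5.
Proof. by rewrite /phi_cross sgnM !sgn_phi // opprK. Qed.

(** After the factor q, U_2 reads off the odd part of [phi_cross], which is half of
    [phi_cross - sgn phi_cross]; [theta_T] evaluates that difference. *)
Lemma dec2_phi_cross : dec 2 (q * phi_cross) = 2 * q * (eta 2 * eta 10).
Proof.
suff : 2 * dec 2 (q * phi_cross) = 2 * (2 * q * (eta 2 * eta 10)).
  move=> e; apply/funext => n; have := congr1 (fun f : series => f n) e.
  by rewrite /= !mulr_natl !serMn; lia.
transitivity (dec 2 (q * (phi_cross - sgn phi_cross))).
  apply/funext => -[|n]; rewrite /dec mulr_natl serMn ?muln0 ?qM0 //.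
  by rewrite mulnS !qMS serB sgnE -signr_odd /= oddM /= mulN1r opprK mulr2n.
rewrite sgn_phi_cross /phi_cross theta_T !(@eta_theta 4) // (@eta_theta 20) //.
have -> : q * (4 * q * (eta 4 * eta 20)) = dil 2 (q * (eta 2 * eta 10)) *+ 4.
  by rewrite !dilM // dilq // !dil_eta //; ring.
by rewrite decMn dilK //; ring.
Qed.

Lemma dec2_sgn_phi_cross : dec 2 (q * sgn phi_cross) = - (2 * q * (eta 2 * eta 10)).
Proof.
rewrite -dec2_phi_cross; apply/funext => -[|n]; rewrite serN /dec ?muln0 ?qM0 //.
by rewrite mulnS !qMS sgnE -signr_odd /= oddM mulN1r.
Qed.

Lemma G1BG2E : G1 - G2 = q * (psi1 * psi5 * K).
Proof. by rewrite /G1 /G2 -KE; ring. Qed.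

Lemma G1B5G2E : G1 - 5 * G2 = q * (psi1 * psi5 * L).
Proof. by rewrite /G1 /G2; ring. Qed.

(** Multiplying by phi(-q)^2 lets phi(-q^2)^2 = phi(q) phi(-q) enter under U_2. Since (G1 - G2)
    phi(-q) = q f_2^2 f_10^2 phi(-q^5), what remains under U_2 is q [phi_cross] times a series in
    q^2. *)
Lemma dec2_G1BG2 : dec 2 (G1 - G2) = 2 * (G1 - G2).
Proof.
have Jphi : (G1 - G2) * theta (-1) 1 1 = q * (eta 2 * eta 10) ^+ 2 * theta (-1) 5 5.
  apply: (@serI (eta 1 ^+ 2 * eta 5 * eta 10 * eta 2)).
    by rewrite !(serM0, serX0, eta0).
  transitivity (q * (psi1 * eta 1) * (psi5 * eta 5) * (K * (eta 1 * eta 10))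
                * (theta (-1) 1 1 * eta 2)); first by rewrite G1BG2E; ring.
  rewrite psi1_eta psi5_eta AB_eta phi1_eta.
  transitivity (q * (eta 2 * eta 10) ^+ 2 * (theta (-1) 5 5 * eta 10) * eta 1 ^+ 2 * eta 5 * eta 2).
    by rewrite phi5_eta; ring.
  by ring.
apply: (@serI (theta (-1) 1 1 ^+ 2)); first by rewrite serX0 theta0.
rewrite -dec_dilM // dilX // dil_theta // -phi_phi //.
have -> : theta 1 1 1 * theta (-1) 1 1 * (G1 - G2) =
    dil 2 ((eta 1 * eta 5) ^+ 2) * (q * phi_cross).
  rewrite -mulrA [_ * (G1 - G2)]mulrC Jphi dilX // dilM // !dil_eta // /phi_cross.
  by ring.
rewrite dec_dilM // dec2_phi_cross.
transitivity (2 * theta (-1) 1 1 * ((G1 - G2) * theta (-1) 1 1)); last by ring.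
rewrite Jphi.
transitivity (2 * q * (theta (-1) 1 1 * eta 2) * (theta (-1) 5 5 * eta 10) * eta 2 * eta 10).
  by rewrite phi1_eta phi5_eta; ring.
by ring.
Qed.

(** The same argument with phi(-q^5) as multiplier leads to [sgn phi_cross], whose odd part is
    opposite; hence the sign. *)
Lemma dec2_G1B5G2 : dec 2 (G1 - 5 * G2) = - (2 * (G1 - 5 * G2)).
Proof.
have Ephi : (G1 - 5 * G2) * theta (-1) 5 5 = q * (eta 2 * eta 10) ^+ 2 * theta (-1) 1 1.
  apply: (@serI (eta 1 * eta 5 ^+ 2 * eta 10 * eta 2)).
    by rewrite !(serM0, serX0, eta0).
  transitivity (q * (psi1 * eta 1) * (psi5 * eta 5) * (L * (eta 2 * eta 5))
                * (theta (-1) 5 5 * eta 10)); first by rewrite G1B5G2E; ring.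
  rewrite psi1_eta psi5_eta L_eta phi5_eta.
  transitivity (q * (eta 2 * eta 10) ^+ 2 * (theta (-1) 1 1 * eta 2) * eta 1 * eta 5 ^+ 2 * eta 10).
    by rewrite phi1_eta; ring.
  by ring.
apply: (@serI (theta (-1) 5 5 ^+ 2)); first by rewrite serX0 theta0.
rewrite -dec_dilM // dilX // dil_theta // -phi_phi //.
have -> : theta 1 5 5 * theta (-1) 5 5 * (G1 - 5 * G2) =
    dil 2 ((eta 1 * eta 5) ^+ 2) * (q * sgn phi_cross).
  rewrite -mulrA [_ * (G1 - _)]mulrC Ephi dilX // dilM // !dil_eta // sgn_phi_cross.
  by ring.
rewrite dec_dilM // dec2_sgn_phi_cross.
transitivity (- (2 * theta (-1) 5 5 * ((G1 - 5 * G2) * theta (-1) 5 5))); last by ring.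
rewrite Ephi.
transitivity (- (2 * q * (theta (-1) 1 1 * eta 2) * (theta (-1) 5 5 * eta 10) * eta 2 * eta 10)).
  by rewrite phi1_eta phi5_eta; ring.
by ring.
Qed.

(** Apply U_2 to 4 G2 = (G1 - G2) - (G1 - 5 G2), then cancel 4 in each coefficient. *)
Lemma dec2_G2 : dec 2 G2 = G1 - 3 * G2.
Proof.
have e1 := dec2_G1BG2; have e2 := dec2_G1B5G2.
apply/funext => n.
have := congr1 (fun f : series => f n) e1.
have := congr1 (fun f : series => f n) e2.
rewrite /= /dec !mulr_natl !(serE, serMn); lia.
Qed.

Lemma psi_dissect : psi1 = dil 5 (theta 1 2 3) + q * dil 5 (theta 1 1 4) + q ^+ 3 * dil 5 psi5.
Proof. by rewrite !dil_theta // psi_dissection. Qed.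

(** R^3 is a series in q^5 and leaves U_5 as P^3; in q^2 P only the third term of the dissection has
    exponents divisible by 5. *)
Lemma dec5_G2 : dec 5 G2 = G1.
Proof.
have -> : G2 = dil 5 (psi1 ^+ 3) * (q ^+ 2 * psi1) by rewrite dilX // dil_theta //= /G2; ring.
rewrite dec_dilM // {2}psi_dissect.
have -> : q ^+ 2 * (dil 5 (theta 1 2 3) + q * dil 5 (theta 1 1 4) + q ^+ 3 * dil 5 psi5) =
  q ^+ (5 * 0 + 2) * dil 5 (theta 1 2 3) + q ^+ (5 * 0 + 3) * dil 5 (theta 1 1 4)
  + q ^+ (5 * 1 + 0) * dil 5 psi5 by rewrite /=; ring.
by rewrite !decD !dec_qX //= /G1; ring.
Qed.

(** After multiplication by q, a monomial with j factors [b] and k factors [c] has exponent 1 + j +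
    3 k modulo 5. Only [a * b * c] and [c ^+ 3] reach residue 0. *)
Lemma dec5_cube (a b c : series) :
  dec 5 (q * (dil 5 a + q * dil 5 b + q ^+ 3 * dil 5 c) ^+ 3) =
  6 * q * (a * b * c) + q ^+ 2 * c ^+ 3.
Proof.
have -> : q * (dil 5 a + q * dil 5 b + q ^+ 3 * dil 5 c) ^+ 3 =
    q ^+ (5 * 0 + 1) * dil 5 (a ^+ 3)
  + q ^+ (5 * 0 + 2) * dil 5 (a ^+ 2 * b) *+ 3
  + q ^+ (5 * 0 + 3) * dil 5 (a * b ^+ 2) *+ 3
  + q ^+ (5 * 0 + 4) * dil 5 (b ^+ 3)
  + q ^+ (5 * 0 + 4) * dil 5 (a ^+ 2 * c) *+ 3
  + q ^+ (5 * 1 + 0) * dil 5 (a * b * c) *+ 6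
  + q ^+ (5 * 1 + 1) * dil 5 (b ^+ 2 * c) *+ 3
  + q ^+ (5 * 1 + 2) * dil 5 (a * c ^+ 2) *+ 3
  + q ^+ (5 * 1 + 3) * dil 5 (b * c ^+ 2) *+ 3
  + q ^+ (5 * 2 + 0) * dil 5 (c ^+ 3).
  rewrite !(dilX, dilM) //=.
  by move: (dil 5 a) (dil 5 b) (dil 5 c) => x y z; ring.
rewrite !(decMn, decD) !dec_qX //=; ring.
Qed.

Lemma dec5_G1 : dec 5 G1 = 6 * G1 - 5 * G2.
Proof.
have -> : G1 = dil 5 psi1 * (q * psi1 ^+ 3) by rewrite dil_theta //= /G1; ring.
rewrite dec_dilM // [in X in dec 5 X]psi_dissect dec5_cube -KE.
by rewrite dil_theta //= /G2; ring.
Qed.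

Lemma dec5_G1BG2 : dec 5 (G1 - G2) = 5 * (G1 - G2).
Proof. by rewrite decD decN dec5_G1 dec5_G2; ring. Qed.

(** * The quotient R^5 / P and its coefficient recurrences *)

Section Quotient.
Variable c : series.
Hypothesis cP : c * psi1 = psi5 ^+ 5.

Let H2 : series := G2 - q ^+ 3 * c.
Let H : series := G1 - G2 - H2.

(** Multiplied by P, the two series become H2 P = q^2 R^3 K and H P = q R K^2. Substituting q^2 for
    q in the second leaves an identity between eta products. *)
Let H2_dil : H2 = dil 2 H.
Proof.
have H2P : H2 * psi1 = q ^+ 2 * psi5 ^+ 3 * K.
  transitivity (G2 * psi1 - q ^+ 3 * (c * psi1)); first by rewrite /H2; ring.
  by rewrite cP /G2 -KE; ring.
have HP : H * psi1 = q * psi5 * K ^+ 2.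
  transitivity ((G1 - G2) * psi1 - H2 * psi1); first by rewrite /H; ring.
  by rewrite H2P G1BG2E -KE; ring.
have theta10 a b : (0 < a)%N -> (0 < b)%N -> theta 1 a b 0%N = 1.
  by move=> a0 b0; rewrite theta0.
apply: (@serI (psi1 * theta 1 2 6 * (eta 1 * eta 5 ^+ 3 * eta 10 * eta 2 ^+ 2 * eta 20 ^+ 2))).
  by rewrite !(serM0, serX0, eta0, theta10).
have P2 : theta 1 2 6 * eta 2 = eta 4 ^+ 2 by exact: (@psi_eta 2).
have R2 : theta 1 10 30 * eta 10 = eta 20 ^+ 2 by exact: (@psi_eta 10).
have K2 : dil 2 K * (eta 2 * eta 20) = eta 4 * eta 10 ^+ 3.
  by have := congr1 (dil 2) AB_eta; rewrite !(dilX, dilM) ?dil_eta.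
have dil_quot (h p r k : series) : h * p = q * r * k ^+ 2 ->
    dil 2 h * dil 2 p = q ^+ 2 * dil 2 r * dil 2 k ^+ 2.
  have d2 : (0 < 2)%N by [].
  move=> e; rewrite -(dilM h p d2) e (dilM (q * r) (k ^+ 2) d2) (dilM q r d2).
  by rewrite (dilq d2) (dilX k 2 d2).
have H2E : dil 2 H * theta 1 2 6 = q ^+ 2 * theta 1 10 30 * dil 2 K ^+ 2.
  have P2' : dil 2 psi1 = theta 1 2 6 by exact: dil_theta.
  have R2' : dil 2 psi5 = theta 1 10 30 by exact: dil_theta.
  by rewrite -P2' -R2'; exact: dil_quot HP.
transitivity (q ^+ 2 * (psi5 * eta 5) ^+ 3 * (K * (eta 1 * eta 10)) *
   (theta 1 2 6 * eta 2) * (eta 2 * eta 20 ^+ 2)).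
  transitivity (H2 * psi1 * (theta 1 2 6 * (eta 1 * eta 5 ^+ 3 * eta 10 * eta 2 ^+ 2 * eta 20 ^+ 2))).
    by move: (H2) => h2; ring.
  by rewrite H2P; ring.
rewrite psi5_eta AB_eta P2.
transitivity (q ^+ 2 * (theta 1 10 30 * eta 10) * (dil 2 K * (eta 2 * eta 20)) ^+ 2 *
   (psi1 * eta 1) * eta 5 ^+ 3).
  by rewrite R2 K2 psi1_eta; ring.
transitivity (dil 2 H * theta 1 2 6 * psi1 * (eta 1 * eta 5 ^+ 3 * eta 10 * eta 2 ^+ 2 * eta 20 ^+ 2)).
  by rewrite H2E; ring.
by move: (dil 2 H) => h; ring.
Qed.

Let q3cE n : (q ^+ 3 * c) n = G2 n - (if odd n then 0 else H n./2).
Proof.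
have -> : q ^+ 3 * c = G2 - H2 by rewrite /H2; ring.
by rewrite serB [in LHS]H2_dil /dil dvdn2 divn2; case: odd.
Qed.

Let HE n : H n = G1 n - G2 n - (if odd n then 0 else H n./2).
Proof.
have -> : H n = (G1 n - G2 n) - H2 n by [].
by rewrite [in LHS]H2_dil /dil dvdn2 divn2; case: odd.
Qed.

Let H_dec5 n : H (5 * n)%N = 5 * H n.
Proof.
have [m] := ubnP n; elim: m n => // m IH n ltm.
have e1 : (G1 - G2) (5 * n)%N = 5 * (G1 - G2) n.
  have := congr1 (fun f : series => f n) dec5_G1BG2.
  by rewrite /= /dec mulr_natl serMn mulr_natl.
rewrite !serB in e1; move: e1 (HE n) (HE (5 * n)).
(* At 0 halving does not decrease the index, but [e1] and [HE] force [H 0 = 0]. *)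
have [->|n0] := posnP n; first by rewrite muln0 /=; lia.
rewrite oddM /=; case: ifP => on; first by lia.
have -> : ((5 * n)./2 = 5 * n./2)%N by lia.
rewrite (IH n./2); lia.
Qed.

(** q^3 c is G2 - H(q^2). The polynomial x^2 - 6 x + 5 in U_5 kills G2, by the action on G1 and G2,
    and kills H(q^2), for which U_5 has eigenvalue 5. *)
Lemma q3c_25 n : (q ^+ 3 * c) (25 * n)%N =
  6 * (q ^+ 3 * c) (5 * n)%N - 5 * (q ^+ 3 * c) n.
Proof.
have d1 m : G1 (5 * m)%N = 6 * G1 m - 5 * G2 m.
  have := congr1 (fun f : series => f m) dec5_G1.
  by rewrite /= /dec serB !mulr_natl !serMn.
have d2 m : G2 (5 * m)%N = G1 m := congr1 (fun f : series => f m) dec5_G2.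
have -> : (25 * n = 5 * (5 * n))%N by lia.
rewrite !q3cE !d2 d1 !oddM /=; case: ifP => on; first by lia.
have -> : (5 * (5 * n))./2 = (5 * (5 * n./2))%N by lia.
have -> : (5 * n)./2 = (5 * n./2)%N by lia.
rewrite !H_dec5; lia.
Qed.

(** For odd n, H agrees with G1 - G2 and q^3 c with G2, so the left side is (G1 - 3 G2) - (G1 - G2)
    = - 2 G2 at n. *)
Lemma q3c_2 n : odd n -> (q ^+ 3 * c) (2 * n)%N = - 2 * (q ^+ 3 * c) n.
Proof.
move=> on; rewrite !q3cE oddM /= mul2n doubleK HE on.
have := congr1 (fun f : series => f n) dec2_G2.
rewrite /= /dec serB mulr_natl serMn mul2n; lia.
Qed.

End Quotient.

(** * Closed form of the recurrence and return to [b5bar] *)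

Lemma recurrence_1_5 (x : nat -> rat) :
  (forall k, x k.+2 = 6 * x k.+1 - 5 * x k) ->
  forall k, x k = (5 ^+ k - 1) / 4 * x 1%N - (5 ^+ k - 5) / 4 * x 0%N.
Proof.
move=> rec_x k; pose P k := x k = (5 ^+ k - 1) / 4 * x 1%N - (5 ^+ k - 5) / 4 * x 0%N.
suff: P k /\ P k.+1 by case.
elim: k => [|k [IH1 IH2]]; rewrite /P.
  by split; rewrite ?expr0 ?expr1; field.
by split=> //; rewrite rec_x IH1 IH2 !exprS; field.
Qed.

Lemma q3c_5k (c : series) : c * psi1 = psi5 ^+ 5 -> forall n k,
  ((q ^+ 3 * c) (5 ^ k * n)%N)%:Q =
    (5 ^+ k - 1) / 4 * ((q ^+ 3 * c) (5 * n)%N)%:Q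
    - (5 ^+ k - 5) / 4 * ((q ^+ 3 * c) n)%:Q.
Proof.
move=> cP n k; have := @recurrence_1_5 (fun k => ((q ^+ 3 * c) (5 ^ k * n)%N)%:Q).
rewrite expn0 expn1 mul1n; apply => m.
have -> : (5 ^ m.+2 * n = 25 * (5 ^ m * n))%N by rewrite !expnS; ring.
by rewrite (q3c_25 cP) mulnA -expnS rmorphB !rmorphM.
Qed.

Definition b5 : series := b5bar.

(** The change q -> -q removes the signs, so [sgn b5] can serve as the series [c] of the preceding
    section. *)
Lemma b5_quotient : sgn b5 * psi1 = psi5 ^+ 5.
Proof.
have e1 : (psi_neg 1 : series) = sgn psi1.
  by apply/funext => n; rewrite -psiE /psi_neg /fps_subst dvd1n divn1.
have e5 : (psi_neg 5 : series) = sgn psi5.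
  rewrite -(@dil_theta 5 1 1 3) // -psiE; apply/funext => n.
  rewrite /psi_neg /fps_subst sgnE /dil; case: ifP => [/dvdnP[m ->]|]; last by rewrite mulr0.
  (* The sign of index [m * 5] is that of [m], because 5 is odd. *)
  by rewrite mulnK // -[in RHS]signr_odd oddM andbT signr_odd.
have b5K : b5 * sgn psi1 = sgn psi5 ^+ 5.
  have fps_expE (f : series) k : fps_exp f k = f ^+ k.
    by elim: k => // k IH; rewrite exprS -IH.
  by rewrite -e1 -e5 -fps_expE; apply/funext => n; exact: b5barK.
by rewrite -[psi1]sgnK -sgnM b5K sgnX sgnK.
Qed.

Lemma b5barE n : b5bar n = (-1) ^+ n * (q ^+ 3 * sgn b5) (n + 3)%N.
Proof. by rewrite addnC qXMD sgnE mulrA -exprMn mulrNN mulr1 expr1n mul1r. Qed.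

Theorem theorem4 (n k : nat) (hk : (2 <= k)%N) :
  b5bar (4 * n + 3)%N = 2 * b5bar (2 * n)%N /\
  (b5bar (5 ^ k * (n + 3) - 3)%N)%:Q =
    (5 ^+ k - 1) / 4 * (b5bar (5 * n + 12)%N)%:Q
    - (5 ^+ k - 5) / 4 * (b5bar n)%:Q.
Proof.
have q3c_5 := q3c_5k b5_quotient; split.
  (* After the shift by 3, the index is twice the odd number [2 * n + 3], and the factor - 2 of
     [q3c_2] meets the opposite signs of the two indices. *)
  rewrite !b5barE; have -> : (4 * n + 3 + 3 = 2 * (2 * n + 3))%N by lia.
  rewrite (q3c_2 b5_quotient); last by lia.
  rewrite -signr_odd -[_ ^+ (2 * n)]signr_odd.
  have -> : odd (4 * n + 3) = true by lia.
  have -> : odd (2 * n) = false by lia.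
  by rewrite expr0 expr1; ring.
have gt0 : (0 < 5 ^ k)%N by rewrite expn_gt0.
(* This makes the truncated subtraction of 3 an exact one. *)
have le3 : (3 <= 5 ^ k * (n + 3))%N by nia.
rewrite !b5barE subnK // (_ : 5 * n + 12 + 3 = 5 * (n + 3))%N; last by lia.
(* All three indices have the parity of [n], so the signs from [b5barE] are a common factor. *)
have par : odd (5 ^ k * (n + 3) - 3) = odd n.
  by rewrite oddB // oddM oddX orbT /= oddD addbK.
have par' : odd (5 * n + 12) = odd n by lia.
rewrite -!(signr_odd _ (_ - 3)) -(signr_odd _ (5 * n + 12)) -(signr_odd _ n) par par'.
rewrite !rmorphM /= q3c_5; ring.
Qed.
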